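(* Let $d\ge2$ and $n,m\ge1$ be integers, and let $\mathcal{N}$ be a quantum channel from $n$ qudits to $m$ qudits with Choi rank $K$. Using $\lceil \log_dK \rceil+m-n$ ancilla qudits each initialized to $|0\rangle$, the number of CINC gates required for a quantum circuit model of $\mathcal{N}$ is at most $N(d,n,\lceil \log_dK \rceil+m)$. Moreover, if $d$ is prime, the number of SUM gates required (for a circuit model built from SUM gates and single-qudit gates) is at most $d\,N(d,n,\lceil \log_dK \rceil+m)$. Here $$N(d,n,r)=4d^n\Big(\frac{d^r-1}{d-1}-r\Big)+d^nN_{\mathrm{U}}(d,r).$$
   Context: $N_{\mathrm{U}}(d,r)=2+\sum_{s=3}^{r}\min\{N_{\mathrm{SU}}^{\mathrm{rec}}(s),N_{\mathrm{SU}}(d,s)\}$ (the sum being empty, i.e. $N_{\mathrm U}(d,r)=2$, for $r\le2$), where for $3\le s\le6$ the minimum is taken to be $N_{\mathrm{SU}}^{\mathrm{rec}}(s)$. Here, for $s\ge3$, $N^{\mathrm{rec}}_{\mathrm{SU}}(s)=2^{2k}+3\cdot 2^{k}(s-2^{k}-1)$ with $k=\lfloor\log_2(s-1)\rfloor$; and for $s\ge 7$, $N_{\mathrm{SU}}(d,s)$ equals $16s-48$ if $d=2$, $32s-160$ if $d=3$, and $(32d-40)s-192d+272$ if $d\ge4$. $\mathcal{H}_{d}$ is a $d$-dimensional complex Hilbert space with orthonormal (computational) basis $|0\rangle,\dots,|d-1\rangle$ (a qudit). A quantum channel from $n$ to $m$ qudits is a linear, completely positive, trace-preserving map from operators on $\mathcal{H}_d^{\otimes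 n}$ to operators on $\mathcal{H}_d^{\otimes m}$; its Choi rank is the rank of $J_{\mathcal{N}}=\sum_{x,y\in\{0,\dots,d-1\}^n}\mathcal{N}(|x\rangle\langle y|)\otimes|x\rangle\langle y|$. $X_d=|0\rangle\langle d-1|+\sum_{a=0}^{d-2}|a+1\rangle\langle a|$. A CINC gate is, for some positions $i\ne j$, the unitary that on a computational basis vector $|x_1x_2\dots\rangle$ applies $X_d$ to the $j$-th tensor factor if $x_i=d-1$ and acts as the identity otherwise. A SUM gate is, for some $i\neq j$, the unitary that applies $X_d^{x_i}$ to the $j$-th tensor factor. A single-qudit gate is an arbitrary unitary acting nontrivially on one tensor factor only (their number is not restricted). With $l=\lceil\log_dK\rceil$, a quantum circuit model of $\mathcal{N}$ using $l+m-n$ ancilla qudits is a finite product $W$ of CINC (respectively SUM) gates and single-qudit gates on $l+m$ qudits such that $\mathcal{N}(\rho)=\mathrm{Tr}_{1,\dots,l}\big[W\big(|0\rangle\langle0|^{\otimes(l+m-n)}\otimes\rho\big)W^\dagger\big]$ for all density operators $\rho$ on $\mathcal{H}_d^{\otimes n}$, where $\mathrm{Tr}_{1,\dots,l}$ is the partial trace over the first $l$ qudits (realized by measuring them in the computational basis and discarding the outcomes). *)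

(* Defs.v *)
From HB Require Import structures.
From mathcomp Require Import all_boot all_order all_algebra.
From mathcomp Require Export complex.
From mathcomp Require Export reals.

Set Implicit Arguments.
Unset Strict Implicit.
Unset Printing Implicit Defensive.

Import Order.TTheory GRing.Theory Num.Theory.
Local Open Scope ring_scope.
Local Open Scope sesquilinear_scope.

(* Operators on n qudits are matrices whose rows and columns enumerate the
   words in {0, ..., d-1}^n, i.e. the computational basis. *)
Definition word (d n : nat) := {ffun 'I_n -> 'I_d}.
Definition qop (C : Type) (d n : nat) := 'M[C]_#|{: word d n}|.

Definition lword d m n (x : word d (m + n)) : word d m :=
  [ffun i => x (lshift n i)].
Definition rword d m n (x : word d (m + n)) : word d n :=
  [ffun i => x (rshift m i)].
Definition catword d m n (x : word d m) (y : word d n) : word d (m + n) :=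
  [ffun k => match split k with inl i => x i | inr j => y j end].

Section Operators.
Variables (C : numClosedFieldType) (d : nat).
Local Notation qop := (qop C d).

Definition mkop n (F : word d n -> word d n -> C) : qop n :=
  \matrix_(i, j) F (enum_val i) (enum_val j).

(* entry A x y is <x| A |y>. *)
Definition entry n (A : qop n) (x y : word d n) : C :=
  A (enum_rank x) (enum_rank y).

Definition ketbra n (x y : word d n) : qop n :=
  delta_mx (enum_rank x) (enum_rank y).

Definition tensor m n (A : qop m) (B : qop n) : qop (m + n) :=
  mkop (fun x y => entry A (lword x) (lword y) * entry B (rword x) (rword y)).

Definition ptrace l m (A : qop (l + m)) : qop m :=
  mkop (fun x y => \sum_(t : word d l) entry A (catword t x) (catword t y)).

(* |0><0| tensored k times. *)
Definition zero_state k : qop k :=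
  mkop (fun x y =>
    ([forall i, (x i == 0 :> nat)%N] && [forall i, (y i == 0 :> nat)%N])%:R).

(* Over C, 0 <= z means that z is real and nonnegative; in particular this
   condition forces A to be Hermitian. *)
Definition psd p (A : 'M[C]_p) : Prop :=
  forall v : 'cV[C]_p, 0 <= (v^t* *m A *m v) 0 0.

Definition density n (rho : qop n) : Prop := psd rho /\ \tr rho = 1.

(* Positivity of id_k (x) Phi for every k: an operator on C^k (x) H is a k x k
   block matrix of operators on H, and id_k (x) Phi acts blockwise. *)
Definition completely_positive p q (Phi : 'M[C]_p -> 'M[C]_q) : Prop :=
  forall (k : nat) (A : 'I_k -> 'I_k -> 'M[C]_p),
    psd (\mxblock_(i < k, j < k) A i j) ->
    psd (\mxblock_(i < k, j < k) Phi (A i j)).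

Definition trace_preserving p q (Phi : 'M[C]_p -> 'M[C]_q) : Prop :=
  forall A, \tr (Phi A) = \tr A.

Definition quantum_channel n m (Phi : {linear qop n -> qop m}) : Prop :=
  completely_positive Phi /\ trace_preserving Phi.

Definition choi n m (Phi : {linear qop n -> qop m}) : qop (m + n) :=
  \sum_(x : word d n) \sum_(y : word d n) tensor (Phi (ketbra x y)) (ketbra x y).

Definition choi_rank n m (Phi : {linear qop n -> qop m}) : nat :=
  \rank (choi Phi).

(* U on the i-th tensor factor, identity on the others. *)
Definition local_op r (i : 'I_r) (U : 'M[C]_d) : qop r :=
  mkop (fun x y => U (x i) (y i) *+ [forall k, (k != i) ==> (x k == y k)]).

(* ordS a is a + 1 modulo d. *)
Definition Xd : 'M[C]_d := \matrix_(a, b) (a == ordS b)%:R.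

(* |y> is sent to the image of |y> under Xd ^+ e (y i) acting on the j-th
   factor. *)
Definition controlled_X (e : 'I_d -> nat) r (i j : 'I_r) : qop r :=
  mkop (fun x y => entry (local_op j (Xd ^+ e (y i))) x y).

Definition CINC r (i j : 'I_r) : qop r :=
  controlled_X (fun a => (a == d.-1 :> nat)%N : nat) i j.
Definition SUM r (i j : 'I_r) : qop r :=
  controlled_X (fun a => a : nat) i j.

(* circuit G k W: W is a finite product of single-qudit gates and of exactly k
   two-qudit gates of the form G i j with i != j. *)
Inductive circuit r (G : 'I_r -> 'I_r -> qop r) : nat -> qop r -> Prop :=
| circuit_nil : circuit G 0 1%:M
| circuit_two k W i j : i != j -> circuit G k W ->
    circuit G k.+1 (G i j *m W)
| circuit_one k W i U : U \is unitarymx -> circuit G k W ->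
    circuit G k (local_op i U *m W).

(* The existence of e, i.e. a + n = l + m, says that the a ancilla qudits and
   the n input qudits make up the register on which W acts. *)
Definition circuit_model n m (Phi : {linear qop n -> qop m}) (a l : nat)
    (W : qop (l + m)) : Prop :=
  exists e : (a + n = l + m)%N, forall rho : qop n, density rho ->
    Phi rho =
      ptrace (W *m ecast r (qop r) e (tensor (zero_state a) rho) *m W^t*).

End Operators.

Section Bounds.
Local Open Scope nat_scope.

(* In the ranges used by NU and N_bound, no truncated subtraction below
   truncates and the division is exact. *)

Definition NSU_rec (s : nat) : nat :=
  let k := trunc_log 2 s.-1 in
  2 ^ (2 * k) + 3 * 2 ^ k * (s - 2 ^ k - 1).

Definition NSU (d s : nat) : nat :=
  if d == 2 then 16 * s - 48
  else if d == 3 then 32 * s - 160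
  else (32 * d - 40) * s + 272 - 192 * d.

Definition NU (d r : nat) : nat :=
  2 + \sum_(3 <= s < r.+1)
        (if s <= 6 then NSU_rec s else minn (NSU_rec s) (NSU d s)).

Definition N_bound (d n r : nat) : nat :=
  4 * d ^ n * ((d ^ r - 1) %/ (d - 1) - r) + d ^ n * NU d r.

End Bounds.

(* Main.v *)
Require Import Defs.
From mathcomp Require Import all_boot all_order all_algebra.
From mathcomp Require Import fingroup perm.
From mathcomp Require Import ring zify.

(* Stinespring: a factorization [J = M M^*] of the Choi matrix with [d^l]
   columns gives an isometry whose [d^n] columns have to be completed to a
   circuit.  The columns are put in place one after the other by generalized
   Householder reflections [1 - c z z^*], each of which fixes the columns
   already placed.  Such a reflection is [S^* D S], where [S] sends [z] to a
   multiple of a basis vector and [D] is a phase on that basis vector.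

   [S] consists of singly controlled gates.  A CINC gate conjugated by local
   gates applies any [a B X B^*] conditionally on one control value, and such a
   unitary can send any vector of C^d to a multiple of any basis vector, because
   the numerical range of [X] contains the segment [0, 1].  Hence [S] needs only
   [T = (d^r - 1)/(d - 1) - r] CINC gates.  The phase [D], built from
   commutators, needs at most [2 T] of them, so one column costs at most [4 T],
   which leaves the [NU] term of the bound unused.

   For prime [d], a product [(SUM B)^d] with [B] diagonal on the target is a
   scalar for every nonzero control value and [B^d] for control value 0; up to
   local gates this is CINC. *)

Set Implicit Arguments.
Unset Strict Implicit.
Unset Printing Implicit Defensive.

Import Order.TTheory GRing.Theory Num.Theory.
Local Open Scope ring_scope.
Local Open Scope sesquilinear_scope.

(** * Adjoints and unitarity *)

Section Adjoint.
Variable C : numClosedFieldType.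

Lemma adjmxE m n (A : 'M[C]_(m, n)) i j : (A^t*) i j = (A j i)^*.
Proof. by rewrite !mxE. Qed.

Lemma adjmx_mul m n p (A : 'M[C]_(m, n)) (B : 'M[C]_(n, p)) :
  (A *m B)^t* = B^t* *m A^t*.
Proof. by rewrite trmx_mul map_mxM. Qed.

Lemma adjmx_scale m n a (A : 'M[C]_(m, n)) : (a *: A)^t* = a^* *: A^t*.
Proof. by apply/matrixP=> i j; rewrite !mxE rmorphM. Qed.

Lemma adjmxD m n (A B : 'M[C]_(m, n)) : (A + B)^t* = A^t* + B^t*.
Proof. by apply/matrixP=> i j; rewrite !mxE rmorphD. Qed.

Lemma adjmxB m n (A B : 'M[C]_(m, n)) : (A - B)^t* = A^t* - B^t*.
Proof. by apply/matrixP=> i j; rewrite !mxE rmorphB. Qed.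

Lemma adjmx1 n : (1%:M : 'M[C]_n)^t* = 1%:M.
Proof. by rewrite trmx1 map_mx1. Qed.

Lemma unitarymx1 n : (1%:M : 'M[C]_n) \is unitarymx.
Proof. by apply/unitarymxP; rewrite adjmx1 mulmx1. Qed.

Lemma unitarymxVP n (U : 'M[C]_n) : U \is unitarymx -> U^t* *m U = 1%:M.
Proof. by rewrite -trmxC_unitary => /unitarymxP; rewrite trmxCK. Qed.

End Adjoint.

(** * Operators in the word basis and multiplexed gates *)

Section Register.
Variables (C : numClosedFieldType) (d r : nat).
Local Notation W := (word d r).
Local Notation Op := (qop C d r).
Implicit Types (A B : Op) (x y z : W) (j : 'I_r) (F G : W -> 'M[C]_d).

Lemma mkopE (f : W -> W -> C) x y : entry (mkop f) x y = f x y.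
Proof. by rewrite /entry mxE !enum_rankK. Qed.

Lemma entryP A B : (forall x y, entry A x y = entry B x y) -> A = B.
Proof.
move=> h; apply/matrixP=> i j.
by have := h (enum_val i) (enum_val j); rewrite /entry !enum_valK.
Qed.

Lemma sum_rank (V : nmodType) (f : 'I_#|{: W}| -> V) :
  \sum_i f i = \sum_z f (enum_rank z).
Proof.
rewrite (reindex (@enum_rank (word d r))) //.
by exists enum_val => z _; rewrite ?enum_rankK ?enum_valK.
Qed.

Lemma entry_mul A B x y :
  entry (A *m B) x y = \sum_z entry A x z * entry B z y.
Proof. by rewrite /entry mxE sum_rank. Qed.

Lemma entry_mulv A (v : 'cV[C]_#|{: W}|) x :
  (A *m v) (enum_rank x) 0 = \sum_z entry A x z * v (enum_rank z) 0.
Proof. by rewrite mxE sum_rank. Qed.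

Lemma entry_adj A x y : entry (A^t*) x y = (entry A y x)^*.
Proof. by rewrite /entry adjmxE. Qed.

Lemma entry1 x y : entry (1%:M : Op) x y = (x == y)%:R.
Proof. by rewrite /entry mxE (inj_eq enum_rank_inj). Qed.

Definition upd x j b : W := [ffun k => if k == j then b else x k].

Lemma upd_eq x j b : upd x j b j = b.
Proof. by rewrite ffunE eqxx. Qed.

Lemma upd_neq x j k b : k != j -> upd x j b k = x k.
Proof. by move=> h; rewrite ffunE (negbTE h). Qed.

Lemma upd_id x j : upd x j (x j) = x.
Proof. by apply/ffunP=> k; rewrite ffunE; case: eqP => // ->. Qed.

(** Spelled exactly as the condition inside [local_op], so that [local_op] is, by conversion, [mux]
    of a constant family. *)
Definition agree j x y := [forall k, (k != j) ==> (x k == y k)].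

Lemma agreeP j x y : reflect (y = upd x j (y j)) (agree j x y).
Proof.
apply: (iffP forallP) => [h|-> k].
  apply/ffunP=> k; rewrite ffunE; have := h k.
  by case: eqP => [->|_ /= /eqP].
by apply/implyP=> hk; rewrite upd_neq.
Qed.

Lemma agree_upd j x b : agree j x (upd x j b).
Proof. by apply/agreeP; rewrite upd_eq. Qed.

Lemma sum_agree (V : nmodType) j x (f : W -> V) :
  \sum_z (f z *+ agree j x z) = \sum_b f (upd x j b).
Proof.
under eq_bigr => z _ do rewrite mulrb.
rewrite -big_mkcond /= (reindex (upd x j)) /=.
  by apply: eq_bigl => b; rewrite agree_upd.
exists (fun z => z j) => [b _|z]; first by rewrite upd_eq.
by rewrite unfold_in => /agreeP.
Qed.

(* A multiplexed gate: the unitary applied to the j-th factor may depend on the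
   other factors; [F y] is meant to ignore [y j], see [free_of]. *)
Definition mux j F : Op :=
  mkop (fun x y => F y (x j) (y j) *+ agree j x y).

Definition free_of j F := forall y b, F (upd y j b) = F y.

Lemma eq_mux j F G : (forall y, F y = G y) -> mux j F = mux j G.
Proof. by move=> h; apply: entryP => x y; rewrite !mkopE h. Qed.

Lemma entry_mux_mul j F A x y : free_of j F ->
  entry (mux j F *m A) x y = \sum_b F x (x j) b * entry A (upd x j b) y.
Proof.
move=> hF; rewrite entry_mul.
under eq_bigr => z _ do rewrite mkopE mulrnAl.
by rewrite sum_agree; apply: eq_bigr => b _; rewrite upd_eq hF.
Qed.

Lemma mux_mulv j F (v : 'cV[C]_#|{: W}|) x : free_of j F ->
  (mux j F *m v) (enum_rank x) 0 =
    \sum_b F x (x j) b * v (enum_rank (upd x j b)) 0.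
Proof.
move=> hF; rewrite entry_mulv.
under eq_bigr => z _ do rewrite mkopE mulrnAl.
by rewrite sum_agree; apply: eq_bigr => b _; rewrite upd_eq hF.
Qed.

(** The left block is read at an intermediate word that differs from [y] at most in position [j];
    freeness of [F] makes it the block at [y]. *)
Lemma mux_mul j F G : free_of j F ->
  mux j F *m mux j G = mux j (fun y => F y *m G y).
Proof.
move=> hF; apply: entryP => x y; rewrite entry_mux_mul // mkopE !mxE.
under eq_bigr => b _ do rewrite mkopE upd_eq.
have e b : agree j (upd x j b) y = agree j x y.
  apply: eq_forallb => k; case: eqP => //= /eqP hk.
  by rewrite upd_neq.
under eq_bigr => b _ do rewrite e mulrnAr.
rewrite -sumrMnl; case: agreeP => //= hy.
by have -> : F y = F x by rewrite hy hF.
Qed.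

Lemma mux1 j : mux j (fun _ => 1%:M) = 1%:M.
Proof.
apply: entryP => x y; rewrite mkopE entry1 mxE.
rewrite -mulrnA mulnb; congr (_ %:R); congr (nat_of_bool _).
apply/andP/eqP => [[/eqP h /agreeP ->]|->]; first by rewrite -h upd_id.
by split=> //; apply/agreeP; rewrite upd_id.
Qed.

Lemma mux_adj j F : free_of j F ->
  (mux j F)^t* = mux j (fun y => (F y)^t*).
Proof.
move=> hF; apply: entryP => x y; rewrite entry_adj !mkopE adjmxE rmorphMn.
have -> : agree j y x = agree j x y.
  by apply: eq_forallb => k; rewrite [x k == _]eq_sym.
by case: agreeP => //= ->; rewrite hF.
Qed.

Lemma mux_unitary j F : free_of j F -> (forall y, F y \is unitarymx) ->
  mux j F \is unitarymx.
Proof.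
move=> hF hU; apply/unitarymxP; rewrite mux_adj // mux_mul // -(mux1 j).
by apply: eq_mux => y; apply/unitarymxP.
Qed.

Lemma mux_diag j (f : W -> 'I_d -> C) :
  mux j (fun y => diag_mx (\row_a f y a)) =
    mkop (fun x y => f y (y j) *+ (x == y)).
Proof.
apply: entryP => x y; rewrite !mkopE !mxE.
case: eqVneq => [e|ne].
  case: agreeP => [->|h]; last first.
    by case: eqP => // exy; case: h; rewrite exy upd_id.
  by rewrite -e upd_id eqxx !mulr1n e.
by rewrite mulr0n mul0rn; case: eqP => // exy; rewrite exy eqxx in ne.
Qed.

End Register.

(** * Gate counts and the transformations that cost only local gates *)

Section Circuits.
Variables (C : numClosedFieldType) (d r : nat).
Local Notation W := (word d r).
Local Notation Op := (qop C d r).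
Variable G : 'I_r -> 'I_r -> Op.
Implicit Types (A B : Op) (x y z : W) (i j : 'I_r) (F : W -> 'M[C]_d).

(** [circuit] counts two-qudit gates exactly; an upper bound can be weakened and composed. *)
Definition cost n A := exists2 k, (k <= n)%N & circuit G k A.

Lemma circuit_mul k1 k2 A B :
  circuit G k1 A -> circuit G k2 B -> circuit G (k1 + k2) (A *m B).
Proof.
move=> hA hB; elim: hA => [|k A' i j ij _ IH|k A' i U hU _ IH].
- by rewrite mul1mx.
- by rewrite -mulmxA addSn; apply: circuit_two.
- by rewrite -mulmxA; apply: circuit_one.
Qed.

Lemma cost_le n n' A : (n <= n')%N -> cost n A -> cost n' A.
Proof. by move=> hn [k hk hA]; exists k => //; apply: leq_trans hn. Qed.

Lemma cost_mul n1 n2 A B : cost n1 A -> cost n2 B -> cost (n1 + n2) (A *m B).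
Proof.
move=> [k1 h1 hA] [k2 h2 hB]; exists (k1 + k2)%N; first exact: leq_add.
exact: circuit_mul.
Qed.

Lemma cost_mull n A B : cost 0 A -> cost n B -> cost n (A *m B).
Proof. exact: cost_mul. Qed.

Lemma cost_mulr n A B : cost n A -> cost 0 B -> cost n (A *m B).
Proof. by rewrite -{2}[n]addn0; apply: cost_mul. Qed.

Lemma cost1 : cost 0 1%:M.
Proof. by exists 0%N => //; apply: circuit_nil. Qed.

Lemma cost_local i (U : 'M[C]_d) : U \is unitarymx -> cost 0 (local_op i U).
Proof.
move=> hU; exists 0%N => //; rewrite -[local_op i U]mulmx1.
by apply: circuit_one => //; apply: circuit_nil.
Qed.

Lemma cost_two i j : i != j -> cost 1 (G i j).
Proof.
move=> ij; exists 1%N => //; rewrite -[G i j]mulmx1.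
by apply: circuit_two => //; apply: circuit_nil.
Qed.

Lemma local_opE i (U : 'M[C]_d) : local_op i U = mux i (fun _ => U).
Proof. by []. Qed.

Lemma free_of_ctl i j (f : 'I_d -> 'M[C]_d) :
  i != j -> free_of j (fun y : W => f (y i)).
Proof. by move=> ij y b; rewrite upd_neq. Qed.

Lemma local_op_unitary i (U : 'M[C]_d) :
  U \is unitarymx -> local_op i U \is unitarymx.
Proof. by move=> hU; rewrite local_opE mux_unitary. Qed.

Lemma local_op_adj i (U : 'M[C]_d) : (local_op i U : Op)^t* = local_op i (U^t*).
Proof. exact: (@mux_adj _ _ _ i (fun=> U)). Qed.

Lemma local_op_mul_mux j U F :
  local_op j U *m mux j F = mux j (fun y => U *m F y).
Proof. by rewrite local_opE mux_mul. Qed.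

Lemma mux_mul_local_op j U F : free_of j F ->
  mux j F *m local_op j U = mux j (fun y => F y *m U).
Proof. by move=> hF; rewrite local_opE mux_mul. Qed.

Lemma mux_scalar j (f : W -> C) :
  mux j (fun y => (f y)%:M) = mkop (fun x y => f y *+ (x == y)).
Proof.
rewrite -(mux_diag j (fun y _ => f y)); apply: eq_mux => y.
by apply/matrixP=> a b; rewrite !mxE.
Qed.

(* A phase depending on the control only is a gate on the control. *)
Lemma local_op_phase i j (f : 'I_d -> C) :
  local_op i (diag_mx (\row_a f a)) = mux j (fun y => (f (y i))%:M).
Proof. by rewrite local_opE (mux_diag i (fun _ => f)) mux_scalar. Qed.

Lemma cost_phase i j (f : 'I_d -> C) :
  (forall a, f a * (f a)^* = 1) -> cost 0 (mux j (fun y => (f (y i))%:M)).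
Proof.
move=> hf; rewrite -(local_op_phase i); apply: cost_local.
apply/unitarymxP/matrixP=> a b; rewrite mxE (bigD1 a) //= big1 ?addr0.
  rewrite adjmxE !mxE; case: (eqVneq b a) => [->|ne].
    by rewrite eqxx !mulr1n hf.
  by rewrite mulr0n rmorph0 mulr0.
by move=> c ca; rewrite !mxE eq_sym (negbTE ca) mulr0n mul0r.
Qed.

(** A global phase is a local gate on any qudit; [i] supplies one, so the register is nonempty. *)
Lemma cost_scalar i (a : C) : a * a^* = 1 -> cost 0 a%:M.
Proof.
move=> ha.
have -> : a%:M = mux i (fun y : W => a%:M) :> Op.
  rewrite (mux_scalar i (fun=> a)).
  by apply: entryP => x y; rewrite mkopE /entry !mxE (inj_eq enum_rank_inj).
exact: (cost_phase i i (f := fun=> a)).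
Qed.

Definition relabel i (s : {perm 'I_d}) x : W := upd x i (s (x i)).

Lemma perm_mx_unitary (s : {perm 'I_d}) : (perm_mx s : 'M[C]_d) \is unitarymx.
Proof.
by apply/unitarymxP; rewrite tr_perm_mx map_perm_mx -perm_mxM mulgV perm_mx1.
Qed.

Lemma entry_relabel i (s : {perm 'I_d}) A x y :
  entry (local_op i (perm_mx s) *m A *m (local_op i (perm_mx s))^t*) x y
    = entry A (relabel i s x) (relabel i s y).
Proof.
have mulP B u v : entry (local_op i (perm_mx s) *m B) u v =
                    entry B (relabel i s u) v.
  rewrite local_opE entry_mux_mul // (bigD1 (s (u i))) //= big1 ?addr0.
    by rewrite !mxE eqxx mul1r.
  by move=> b hb; rewrite !mxE eq_sym (negbTE hb) mul0r.
rewrite -mulmxA mulP -[A in LHS]trmxCK -adjmx_mul entry_adj mulP entry_adj.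
by rewrite conjCK.
Qed.

(** Permuting the basis of the control changes which control value triggers which gate and leaves
    the target alone. *)
Lemma relabel_ctl i j (s : {perm 'I_d}) (f : 'I_d -> 'M[C]_d) : i != j ->
  local_op i (perm_mx s) *m mux j (fun y => f (y i)) *m
    (local_op i (perm_mx s))^t* = mux j (fun y => f (s (y i))).
Proof.
move=> ij; apply: entryP => x y; rewrite entry_relabel !mkopE.
rewrite /relabel !upd_eq !(upd_neq _ _ (_ : j != i)) 1?eq_sym //.
congr (_ *+ nat_of_bool _); apply: eq_forallb => k; congr (_ ==> _).
rewrite !ffunE; case: (k =P i) => [->|//]; exact: (inj_eq perm_inj).
Qed.

Lemma cost_relabel_ctl n i j (s : {perm 'I_d}) (f : 'I_d -> 'M[C]_d) :
  i != j -> cost n (mux j (fun y => f (y i))) ->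
  cost n (mux j (fun y => f (s (y i)))).
Proof.
move=> ij h; rewrite -relabel_ctl // local_op_adj.
apply: cost_mulr; last by apply: cost_local; rewrite trmxC_unitary perm_mx_unitary.
by apply: cost_mull => //; apply: cost_local (perm_mx_unitary s).
Qed.

Lemma cost_target n j (U V : 'M[C]_d) F : free_of j F ->
  U \is unitarymx -> V \is unitarymx ->
  cost n (mux j F) -> cost n (mux j (fun y => U *m F y *m V)).
Proof.
move=> hF hU hV h; rewrite -mux_mul_local_op; last by move=> y b; rewrite hF.
rewrite -local_op_mul_mux; apply: cost_mulr; last exact: cost_local.
by apply: cost_mull => //; apply: cost_local.
Qed.

Lemma cost_phase_ctl n i j (f : 'I_d -> C) (F : W -> 'M[C]_d) : i != j ->
  (forall a, f a * (f a)^* = 1) ->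
  cost n (mux j F) -> cost n (mux j (fun y => f (y i) *: F y)).
Proof.
move=> ij hf h.
under eq_mux do rewrite -mul_scalar_mx.
rewrite -mux_mul; last exact: (free_of_ctl (fun a => (f a)%:M)).
by apply: cost_mull => //; apply: cost_phase.
Qed.

End Circuits.

(** * Inner products and generalized Householder reflections *)

Section Householder.
Variables (C : numClosedFieldType) (p : nat).
Implicit Types (u v w z : 'cV[C]_p).

Definition dot u v : C := (u^t* *m v) 0 0.

Lemma dotE u v : dot u v = \sum_i (u i 0)^* * v i 0.
Proof. by rewrite /dot mxE; apply: eq_bigr => i _; rewrite adjmxE. Qed.

Lemma mul_adj_dot u v : u^t* *m v = (dot u v)%:M.
Proof. exact: mx11_scalar. Qed.

Lemma dotC u v : dot u v = (dot v u)^*.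
Proof.
rewrite !dotE rmorph_sum; apply: eq_bigr => i _.
by rewrite rmorphM /= conjCK mulrC.
Qed.

Lemma dotBr u v w : dot u (v - w) = dot u v - dot u w.
Proof. by rewrite /dot mulmxBr !mxE. Qed.

Lemma dotBl u v w : dot (v - w) u = dot v u - dot w u.
Proof. by rewrite dotC dotBr rmorphB /= -!dotC. Qed.

Lemma dotZr a u v : dot u (a *: v) = a * dot u v.
Proof. by rewrite /dot -scalemxAr mxE. Qed.

Lemma dotZl a u v : dot (a *: u) v = a^* * dot u v.
Proof. by rewrite dotC dotZr rmorphM /= -dotC. Qed.

Lemma dot_ge0 u : 0 <= dot u u.
Proof. by rewrite dotE sumr_ge0 // => i _; rewrite mulrC mul_conjC_ge0. Qed.

Lemma dot_eq0 u : dot u u = 0 -> u = 0.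
Proof.
rewrite dotE => /eqP; rewrite psumr_eq0 => [|i _]; last first.
  by rewrite mulrC mul_conjC_ge0.
move=> /allP h; apply/colP=> i; rewrite mxE.
have := h i; rewrite mem_index_enum => /(_ isT).
by rewrite mulrC mul_conjC_eq0 => /eqP.
Qed.

Lemma dot_unitary (U : 'M[C]_p) u v :
  U \is unitarymx -> dot (U *m u) (U *m v) = dot u v.
Proof.
move=> hU; rewrite /dot adjmx_mul -mulmxA [U^t* *m _]mulmxA.
by rewrite unitarymxVP // mul1mx.
Qed.

Lemma dot_delta (o : 'I_p) v : dot (delta_mx o 0) v = v o 0.
Proof.
rewrite dotE (bigD1 o) //= big1 ?addr0.
  by rewrite !mxE !eqxx conjC1 mul1r.
by move=> i io; rewrite mxE (negbTE io) conjC0 mul0r.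
Qed.

Definition reflection z c : 'M[C]_p := 1%:M - c *: (z *m z^t*).

Lemma reflection_mulv z c v : reflection z c *m v = v - (c * dot z v) *: z.
Proof.
rewrite mulmxBl mul1mx -scalemxAl -mulmxA mul_adj_dot mul_mx_scalar.
by rewrite scalerA.
Qed.

Lemma reflection_fix z c v : dot z v = 0 -> reflection z c *m v = v.
Proof. by move=> h; rewrite reflection_mulv h mulr0 scale0r subr0. Qed.

(** In the product of [1 - c z z^*] with its adjoint, the coefficient of [z z^*] is
    [c c^* <z, z> - c - c^*]. *)
Lemma reflection_unitary z c :
  c + c^* = c * c^* * dot z z -> reflection z c \is unitarymx.
Proof.
move=> h; apply/unitarymxP.
have -> : (reflection z c)^t* = reflection z c^*.
  by rewrite adjmxB adjmx1 adjmx_scale adjmx_mul trmxCK.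
rewrite /reflection mulmxBl mul1mx -scalemxAl mulmxBr mulmx1.
rewrite -scalemxAr -mulmxA [z^t* *m (_ *m _)]mulmxA mul_adj_dot.
rewrite mul_scalar_mx -scalemxAr scalerBr !scalerA.
rewrite -addrA -[RHS]addr0; congr (_ + _).
rewrite opprB addrCA -opprD [c^* *: _ + _]addrC -scalerDl h.
by rewrite mulrA subrr.
Qed.

(** A complex coefficient sends [u] to [w] exactly, with no phase adjustment. If the inner product
    vanishes and [u], [w] have equal norms, then [u = w]; the inverse of 0 being 0, the reflection
    is then the identity. *)
Definition reflection_coef u w := (dot (u - w) u)^-1.

Lemma dot_reflection u w : dot u u = dot w w ->
  dot (u - w) (u - w) = dot (u - w) u + (dot (u - w) u)^*.
Proof.
move=> e; rewrite !(dotBl, dotBr) rmorphB /= -!dotC -e.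
by rewrite opprB; ring.
Qed.

Lemma reflection_coefP u w : dot u u = dot w w ->
  let c := reflection_coef u w in
  c + c^* = c * c^* * dot (u - w) (u - w).
Proof.
move=> e c; rewrite dot_reflection // /c /reflection_coef.
set s := dot _ u; have [->|s0] := eqVneq s 0.
  by rewrite invr0 conjC0 addr0 mulr0.
have s1 : s^* != 0 by rewrite conjC_eq0.
by rewrite fmorphV /=; field; rewrite s0 s1.
Qed.

Lemma reflection_maps u w : dot u u = dot w w ->
  reflection (u - w) (reflection_coef u w) *m u = w.
Proof.
move=> e; rewrite reflection_mulv /reflection_coef.
have [s0|s0] := eqVneq (dot (u - w) u) 0.
  have := dot_reflection e; rewrite s0 conjC0 addr0 => /dot_eq0/eqP.
  rewrite subr_eq0 => /eqP ->.
  by rewrite subrr scaler0 subr0.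
by rewrite mulVf // scale1r opprB addrC subrK.
Qed.

(** The fixed vectors are those with equal inner products with [u] and [w]; this allows one vector
    to be moved while another stays in place. *)
Lemma unitary_maps u w : dot u u = dot w w ->
  exists2 U : 'M[C]_p, U \is unitarymx &
    U *m u = w /\ (forall v, dot (u - w) v = 0 -> U *m v = v).
Proof.
move=> e; exists (reflection (u - w) (reflection_coef u w)).
  exact/reflection_unitary/reflection_coefP.
by split=> [|v]; [exact: reflection_maps|exact: reflection_fix].
Qed.

Lemma unitary_reduces (o : 'I_p) u :
  exists2 U : 'M[C]_p, U \is unitarymx &
    exists b, U *m u = b *: delta_mx o 0.
Proof.
have [|U hU [h _]] := @unitary_maps u (sqrtC (dot u u) *: delta_mx o 0).
  rewrite dotZl dotZr dot_delta mxE !eqxx mulr1 geC0_conj ?sqrtC_ge0 ?dot_ge0 //.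
  by rewrite -expr2 sqrtCK.
by exists U => //; eexists; exact: h.
Qed.

End Householder.

(** * The cyclic shift, its conjugates and its commutators *)

Section Shift.
Variables (C : numClosedFieldType) (d : nat).
Local Notation X := (Xd C d).

Lemma Xd_mul n (A : 'M[C]_(d, n)) a c : (X *m A) a c = A (ord_pred a) c.
Proof.
rewrite mxE (bigD1 (ord_pred a)) //= big1 ?addr0.
  by rewrite !mxE ord_predK eqxx mul1r.
move=> b hb; rewrite !mxE; case: eqP => [e|_]; last by rewrite mul0r.
by rewrite e ordSK eqxx in hb.
Qed.

Lemma mul_adj_Xd n (A : 'M[C]_(n, d)) a c :
  (A *m X^t*) a c = A a (ord_pred c).
Proof. by rewrite -[_ *m _]trmxCK adjmx_mul trmxCK adjmxE Xd_mul adjmxE conjCK. Qed.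

Lemma Xd_unitary : X \is unitarymx.
Proof.
apply/unitarymxP/matrixP=> a c.
rewrite mul_adj_Xd !mxE ord_predK; by [].
Qed.

Lemma ordS_rev (a : 'I_d) : ordS (rev_ord a) = rev_ord (ord_pred a).
Proof.
apply: val_inj => /=; case: a => [[|a] ha] /=.
  rewrite add0n subn1 prednK // modnn modn_small ?prednK //.
  by rewrite subnn.
rewrite -subSn // subSS modnDr !modn_small //.
  exact: ltnW.
by rewrite ltn_subrL /= (leq_trans _ ha).
Qed.

(** Reversing the order of the basis turns the cyclic shift into its inverse. *)
Lemma Xd_adj : exists2 P : 'M[C]_d, P \is unitarymx & X^t* = P *m X *m P^t*.
Proof.
exists (perm_mx (perm (@rev_ord_inj d))); first exact: perm_mx_unitary.
rewrite tr_perm_mx map_perm_mx; apply/matrixP=> a c.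
rewrite -row_permE -col_permE adjmxE !mxE !permE rmorph_nat ordS_rev.
congr (_ %:R); congr (nat_of_bool _).
by rewrite (inj_eq rev_ord_inj) -[RHS](inj_eq (can_inj (@ordSK d)))
   ord_predK eq_sym.
Qed.

(* The unitaries that a single CINC gate can apply conditionally on one basis
   state of the control. *)
Definition Xd_conj (U : 'M[C]_d) : Prop :=
  exists a (B : 'M[C]_d),
    [/\ a * a^* = 1, B \is unitarymx & U = a *: (B *m X *m B^t*)].

Lemma Xd_conj_X : Xd_conj X.
Proof.
exists 1, 1%:M; split; rewrite ?conjC1 ?mulr1 ?unitarymx1 //.
by rewrite scale1r mul1mx adjmx1 mulmx1.
Qed.

Lemma Xd_conj_adj U : Xd_conj U -> Xd_conj (U^t*).
Proof.
move=> [a [B [ha hB ->]]]; have [P hP e] := Xd_adj.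
exists a^*, (B *m P); split; first by rewrite conjCK mulrC.
  exact: mul_unitarymx.
by rewrite adjmx_scale !adjmx_mul trmxCK e !mulmxA.
Qed.

(** A unitary [B] can carry a pair of unit vectors [u], [X u] to [v], [w] once [<u, X u> = <v, w>];
    then [B X B^*] sends [v] to [w]. Here [w] is the basis vector with a phase that makes [<v, w>]
    the real number [t] in [0, 1]. *)
Lemma Xd_conj_maps (o : 'I_d) (v : 'cV[C]_d) : (2 <= d)%N -> dot v v = 1 ->
  exists2 U, Xd_conj U & exists b, U *m v = b *: delta_mx o 0.
Proof.
move=> hd hv; set t := `|v o 0|.
have d0 : d%:R != 0 :> C by rewrite pnatr_eq0 -lt0n (ltn_trans _ hd).
have t0 : 0 <= t by exact: normr_ge0.
have t1 : t <= 1.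
  rewrite -(expr_le1 (_ : 0 < 2)%N) // normCK -hv dotE (bigD1 o) //= mulrC.
  by rewrite lerDl sumr_ge0 // => i _; rewrite mulrC mul_conjC_ge0.
have [phi hphi vphi] : exists2 phi : C, phi * phi^* = 1 &
    dot v (phi *: delta_mx o 0) = t.
  have [v0|v0] := eqVneq (v o 0) 0.
    exists 1; first by rewrite conjC1 mulr1.
    by rewrite dotZr dotC dot_delta /t v0 normr0 conjC0 mulr0.
  have t_n0 : t != 0 by rewrite normr_eq0.
  exists (v o 0 / t).
    rewrite rmorphM fmorphV /= (geC0_conj t0) mulrACA -normCK -/t -expr2 exprVn.
    by rewrite mulfV ?expf_neq0.
  by rewrite dotZr dotC dot_delta mulrAC -normCK -/t expr2 mulfK.
(* [u = x e_o + y (1, ..., 1)] is a unit vector with [<u, X u> = t] *)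
pose x := sqrtC (1 - t); pose S := sqrtC (1 - t + d%:R * t).
have hx : x ^+ 2 = 1 - t by rewrite sqrtCK.
have hS : S ^+ 2 = 1 - t + d%:R * t by rewrite sqrtCK.
have x0 : 0 <= x by rewrite sqrtC_ge0 subr_ge0.
have S0 : 0 <= S by rewrite sqrtC_ge0 addr_ge0 ?subr_ge0 ?mulr_ge0 ?ler0n.
(* [y] solves [d y^2 + 2 x y = t]. The left side is [<u, X u>], and adding [x^2 = 1 - t] to it gives
   [<u, u> = 1]. *)
pose y := (S - x) / d%:R.
have hy : x * y *+ 2 + d%:R * y ^+ 2 = t.
  have -> : x * y *+ 2 + d%:R * y ^+ 2 = (S ^+ 2 - x ^+ 2) / d%:R.
    by rewrite /y; field.
  by rewrite hS hx addrAC subrr add0r mulrC mulKf.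
have xc : x^* = x by apply: geC0_conj.
have yc : y^* = y.
  by rewrite rmorphM fmorphV rmorphB /= !geC0_conj ?ler0n.
have sum_o (a : 'I_d) : \sum_(i < d) (i == a)%:R = 1 :> C.
  by rewrite (bigD1 a) //= eqxx big1 ?addr0 // => i /negbTE ->.
pose u : 'cV[C]_d := \col_i (x * (i == o)%:R + y).
have huu : dot u u = 1.
  rewrite dotE.
  have e i : (u i 0)^* * u i 0
      = (x ^+ 2 + x * y *+ 2) * (i == o)%:R + y ^+ 2.
    rewrite !mxE rmorphD rmorphM /= xc yc conjC_nat.
    by case: (i == o); rewrite /= ?mulr1 ?mulr0; ring.
  under eq_bigr => i _ do rewrite e.
  rewrite big_split /= -mulr_sumr sum_o sumr_const card_ord mulr1
    -[y ^+ 2 *+ d]mulr_natl.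
  by rewrite -addrA hy hx subrK.
have huX : dot u (X *m u) = t.
  rewrite dotE.
  have e i : (u i 0)^* * (X *m u) i 0
      = x * y * (i == o)%:R + x * y * (i == ordS o)%:R + y ^+ 2.
    rewrite Xd_mul !mxE rmorphD rmorphM /= xc yc conjC_nat.
    have -> : (ord_pred i == o) = (i == ordS o).
      by rewrite -(inj_eq (can_inj (@ordSK d))) ord_predK.
    case: (eqVneq i o) => [->|_]; last first.
      by case: (i == _); rewrite /= ?mulr1 ?mulr0; ring.
    (* For [d >= 2] the shift has no fixed point, so no term [x^2] enters [<u, X u>]. *)
    have -> : (o == ordS o) = false.
      apply/negbTE/eqP => /(congr1 val) /= e.
      move: (ltn_ord o); rewrite leq_eqVlt => /orP[/eqP h|h].
        by move: e; rewrite h modnn => e; rewrite -h e in hd.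
      move: e; rewrite modn_small // => /eqP.
      by rewrite -{1}[val o]addn0 -addn1 eqn_add2l.
    by rewrite /= ?mulr1 ?mulr0; ring.
  under eq_bigr => i _ do rewrite e.
  rewrite !big_split /= sumr_const card_ord -!mulr_sumr !sum_o !mulr1.
  by rewrite -[y ^+ 2 *+ d]mulr_natl -mulr2n hy.
have [|H1 hH1 [H1u _]] := @unitary_maps _ _ u v; first by rewrite huu hv.
pose w := phi *: delta_mx o 0 : 'cV[C]_d.
have hw : dot w w = 1.
  by rewrite dotZl dotZr dot_delta mxE !eqxx mulr1 mulrC.
have vw1 : dot v (H1 *m (X *m u)) = t by rewrite -H1u dot_unitary.
have [|H2 hH2 [H2w H2fix]] := @unitary_maps _ _ (H1 *m (X *m u)) w.
  by rewrite !dot_unitary ?Xd_unitary // huu hw.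
(* Both [H1 X u] and [w] have inner product [t] with [v], so the second reflection keeps [H1 u = v]
   in place. *)
have H2v : H2 *m v = v by apply: H2fix; rewrite dotBl ![dot _ v]dotC vw1 vphi subrr.
exists (H2 *m H1 *m X *m (H2 *m H1)^t*).
  exists 1, (H2 *m H1); split; rewrite ?conjC1 ?mulr1 ?scale1r //.
  exact: mul_unitarymx.
exists phi; rewrite -/w -H2w -H2v -H1u adjmx_mul !mulmxA.
rewrite -!mulmxA; congr (_ *m (_ *m (_ *m _))).
by rewrite [H2^t* *m _]mulmxA unitarymxVP // mul1mx mulmxA unitarymxVP // mul1mx.
Qed.

Lemma Xd_conj_reduces (o : 'I_d) (u : 'cV[C]_d) : (2 <= d)%N ->
  exists2 U, Xd_conj U & exists b, U *m u = b *: delta_mx o 0.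
Proof.
move=> hd; have [u0|u0] := eqVneq u 0.
  by exists X; [exact: Xd_conj_X|exists 0; rewrite u0 mulmx0 scale0r].
pose n := sqrtC (dot u u).
have n0 : n != 0 by rewrite sqrtC_eq0; apply: contra_neq u0; exact: dot_eq0.
have [|U hU [b hb]] := @Xd_conj_maps o (n^-1 *: u) hd.
  rewrite dotZl dotZr fmorphV /= geC0_conj ?sqrtC_ge0 ?dot_ge0 // mulrA -expr2.
  by rewrite exprVn sqrtCK mulVf // -sqrtC_eq0.
exists U => //; exists (n * b); rewrite -scalerA -hb -scalemxAr scalerA.
by rewrite mulfV // scale1r.
Qed.

(* [Delta = X B X^* B^*] unfolds to [b (a - 1) = Delta a * b a]; the product
   condition makes this solvable around the cycle. *)
Lemma diag_commutator (f : 'I_d -> C) : (0 < d)%N ->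
  (forall a, f a * (f a)^* = 1) -> \prod_a f a = 1 ->
  exists b : 'I_d -> C,
    [/\ forall a, b a * (b a)^* = 1, \prod_a b a = 1 &
        X *m diag_mx (\row_a b a) *m X^t* *m (diag_mx (\row_a b a))^t*
          = diag_mx (\row_a f a)].
Proof.
move=> d0 hf pf.
(* Since [f a] has modulus 1, the recursion reads [b a = (f a)^* b (a - 1)]: partial products solve
   it. *)
pose q (a : 'I_d) := \prod_(c < d | (c <= a)%N) (f c)^*.
have hprod (P : pred 'I_d) (g : 'I_d -> C) : (forall a, g a * (g a)^* = 1) ->
    (\prod_(a | P a) g a) * (\prod_(a | P a) g a)^* = 1.
  by move=> hg; rewrite rmorph_prod -big_split /= big1.
have hq a : q a * (q a)^* = 1 by apply: hprod => c; rewrite conjCK mulrC.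
pose m := \prod_a q a.
have hm : m * m^* = 1 by exact: hprod.
(* A scalar factor of modulus 1 cancels in the commutator; this one makes the product of [b] equal
   to 1, so that [b] can be decomposed in turn. *)
pose s := d.-root m^*.
have hs : s ^+ d = m^* by rewrite rootCK.
have hss : s * s^* = 1.
  apply/eqP; rewrite -(@pexpr_eq1 _ _ d) ?mul_conjC_ge0 //.
  by rewrite exprMn -rmorphXn /= hs conjCK mulrC hm.
have qE a : q (ord_pred a) = f a * q a.
  (* At [a = 0] the predecessor wraps around to [d - 1], where [q] is the full product, equal to 1
     by [pf]. *)
  have [a0|a0] := posnP a.
    have -> : q (ord_pred a) = 1.
      rewrite -(conjC1 C) -pf rmorph_prod; apply: eq_bigl => c.
      by rewrite /= a0 add0n modn_small ?prednK // -ltnS prednK // ltn_ord.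
    rewrite /q (big_pred1 a) ?hf // => c; rewrite a0 leqn0.
    by rewrite /= -(inj_eq val_inj) /= a0.
  rewrite /q [in RHS](bigD1 a) //= mulrA hf mul1r; apply: eq_bigl => c /=.
  rewrite -subn1 -addnBAC // modnDr modn_small.
    by rewrite subn1 -ltnS prednK // ltn_neqAle andbC.
  by rewrite subn1 (leq_ltn_trans (leq_pred _)).
exists (fun a => s * q a); split.
- by move=> a; rewrite rmorphM mulrACA hss hq mulr1.
- by rewrite big_split /= prodr_const card_ord hs mulrC.
- apply/matrixP=> a c; rewrite !mxE.
  under eq_bigr => k _ do rewrite mul_adj_Xd Xd_mul !mxE.
  rewrite (bigD1 c) //= big1 ?addr0; last first.
    by move=> k kc; rewrite [c == k]eq_sym (negbTE kc) mulr0n rmorph0 mulr0.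
  rewrite eqxx mulr1n (inj_eq (can_inj (@ord_predK d))).
  case: eqVneq => [->|_]; last by rewrite !mulr0n mul0r.
  by rewrite !mulr1n qE rmorphM /= mulrACA hss mul1r -mulrA hq mulr1.
Qed.

End Shift.

(** * Controlled gates and reflections built from CINC gates *)

Section CincCircuits.
Variables (C : numClosedFieldType) (d r : nat).
Hypothesis hd : (2 <= d)%N.
Local Notation W := (word d r).
Local Notation Op := (qop C d r).
Local Notation X := (Xd C d).
Local Notation cost := (cost (@CINC C d r)).
Implicit Types (A B : Op) (x y z : W) (i j : 'I_r).

Definition controlled i a (U : 'M[C]_d) y : 'M[C]_d :=
  if y i == a then U else 1%:M.

Lemma free_of_controlled i j a U : i != j -> free_of j (controlled i a U).
Proof. by move=> ij y b; rewrite /controlled upd_neq. Qed.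

Lemma ord_last_proof : (d.-1 < d)%N.
Proof. by rewrite prednK // (ltn_trans _ hd). Qed.

Lemma CINC_mux i j :
  CINC C d i j = mux j (controlled i (Ordinal ord_last_proof) X).
Proof.
apply: entryP => x y; rewrite !mkopE /controlled -val_eqE /=.
by case: eqP; rewrite ?expr1 ?expr0.
Qed.

(** A transposition on the control moves the active value from [d - 1] to [a], the conjugation by
    [B] on the target cancels for the other values, and the scalar is a phase on the control. *)
Lemma cost_controlled i j a U : i != j -> Xd_conj U ->
  cost 1 (mux j (controlled i a U)).
Proof.
move=> ij [b [B [hb hB ->]]]; set o := Ordinal ord_last_proof.
have h0 : cost 1 (mux j (fun y => if y i == o then X else 1%:M)).
  by have := cost_two (@CINC C d r) ij; rewrite CINC_mux.
have h1 : cost 1 (mux j (fun y => if y i == a then X else 1%:M)).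
  have := @cost_relabel_ctl _ _ _ _ 1 i j (tperm a o)
            (fun c => if c == o then X else 1%:M) ij h0.
  congr (cost 1 _); apply: eq_mux => y.
  by rewrite -(inj_eq (@perm_inj _ (tperm a o))) tpermK tpermR.
have h2 := @cost_target _ _ _ _ 1 j B (B^t*) _
  (@free_of_controlled i j a X ij) hB (_ : B^t* \is unitarymx) h1.
have /h2 {}h2 : B^t* \is unitarymx by rewrite trmxC_unitary.
have := @cost_phase_ctl _ _ _ _ 1 i j (fun c => if c == a then b else 1) _ ij _ h2.
have hf c : (if c == a then b else 1) * (if c == a then b else 1)^* = 1.
  by case: ifP; rewrite ?conjC1 ?mulr1.
move=> /(_ hf); congr (cost 1 _); apply: eq_mux => y; rewrite /controlled.
by case: ifP => // _; rewrite mulmx1 (unitarymxP hB) scale1r.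
Qed.

Lemma circuit_unitary k A : circuit (@CINC C d r) k A -> A \is unitarymx.
Proof.
elim=> [|{}k A' i j ij _ IH|{}k A' i U hU _ IH]; first exact: unitarymx1.
  rewrite mul_unitarymx // CINC_mux mux_unitary //.
    exact: free_of_controlled.
  move=> y; rewrite /controlled; case: ifP => _; last exact: unitarymx1.
  exact: Xd_unitary.
by rewrite mul_unitarymx // local_op_unitary.
Qed.

Lemma cost_unitary n A : cost n A -> A \is unitarymx.
Proof. by move=> [k _ /circuit_unitary]. Qed.

(** The adjoint of a CINC gate is a controlled [X^*], again a single CINC gate up to local gates by
    [Xd_adj]. *)
Lemma cost_adj n A : cost n A -> cost n (A^t*).
Proof.
move=> [k hk hA]; apply: cost_le hk _.
elim: hA => [|{}k A' i j ij _ IH|{}k A' i U hU _ IH].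
- by rewrite adjmx1; apply: cost1.
- rewrite adjmx_mul -addn1; apply: cost_mul => //.
  rewrite CINC_mux mux_adj; last exact: free_of_controlled.
  have -> : mux j (fun y => (controlled i (Ordinal ord_last_proof) X y)^t*)
      = mux j (controlled i (Ordinal ord_last_proof) (X^t*)) :> Op.
    by apply: eq_mux => y; rewrite /controlled; case: ifP => // _; rewrite adjmx1.
  exact/cost_controlled/Xd_conj_adj/Xd_conj_X.
- rewrite adjmx_mul local_op_adj; apply: cost_mulr => //.
  by apply: cost_local; rewrite trmxC_unitary.
Qed.

(** * Multiply controlled diagonal gates and phases *)

Section MultiControl.
Variable o : 'I_d.

Definition all_o (s : seq 'I_r) y := all (fun i => y i == o) s.

Lemma all_o_upd s y j b : j \notin s -> all_o s (upd y j b) = all_o s y.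
Proof.
move=> js; apply: eq_in_all => i hi; rewrite upd_neq //.
by apply: contraNneq js => <-.
Qed.

Definition diagf (f : 'I_d -> C) : 'M[C]_d := diag_mx (\row_a f a).

Definition multi_controlled s (U : 'M[C]_d) y : 'M[C]_d :=
  if all_o s y then U else 1%:M.

Lemma free_of_multi_controlled s j U :
  j \notin s -> free_of j (multi_controlled s U).
Proof. by move=> js y b; rewrite /multi_controlled all_o_upd. Qed.

Lemma diagf_adj f : (diagf f)^t* = diagf (fun a => (f a)^*).
Proof.
apply/matrixP=> a b; rewrite !mxE rmorphMn /= eq_sym.
by case: eqVneq => [->|].
Qed.

Lemma diagf_unitary f : (forall a, f a * (f a)^* = 1) -> diagf f \is unitarymx.
Proof.
move=> hf; apply/unitarymxP; rewrite diagf_adj; apply/matrixP=> a b.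
rewrite mul_diag_mx !mxE; case: eqVneq => [->|_]; last by rewrite mulr0.
by rewrite !mulr1n hf.
Qed.

(** The diagonal gate is a commutator of [X] and a diagonal [b]. Control [X] by the first qudit and
    [b] by the others: if either control fails, the commutator collapses to 1. The count satisfies
    [c (k + 1) = 2 c k + 2], [c 0 = 0]. *)
Lemma cost_multi_controlled s j (f : 'I_d -> C) : j \notin s ->
  (forall a, f a * (f a)^* = 1) -> \prod_a f a = 1 ->
  cost (2 ^ (size s).+1 - 2) (mux j (multi_controlled s (diagf f))).
Proof.
elim: s f => [|i s IH] f js hf pf.
  rewrite subnn -[mux _ _]/(local_op j (diagf f)).
  exact/cost_local/diagf_unitary.
have [b [hb pb e]] := diag_commutator (ltnW hd) hf pf.
move: js; rewrite inE negb_or eq_sym => /andP[ij js].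
have hbc a : (b a)^* * (b a)^*^* = 1 by rewrite conjCK mulrC.
have pbc : \prod_a (b a)^* = 1 by rewrite -rmorph_prod pb rmorph1.
have -> : (2 ^ (size (i :: s)).+1 - 2 =
    1 + (2 ^ (size s).+1 - 2) + 1 + (2 ^ (size s).+1 - 2))%N.
  have : (2 <= 2 ^ (size s).+1)%N by rewrite expnS leq_pmulr // expn_gt0.
  by rewrite /= [in LHS]expnS; lia.
have -> : mux j (multi_controlled (i :: s) (diagf f)) =
    mux j (controlled i o X) *m mux j (multi_controlled s (diagf b)) *m
    mux j (controlled i o (X^t*)) *m
    mux j (multi_controlled s (diagf (fun a => (b a)^*))) :> Op.
  have F1 := free_of_controlled o X ij.
  have F2 := free_of_controlled o (X^t*) ij.
  have F3 := free_of_multi_controlled (diagf b) js.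
  rewrite !mux_mul //; first last.
  - by move=> y c; rewrite F1 F3.
  - by move=> y c; rewrite F1 F2 F3.
  apply: eq_mux => y; rewrite /multi_controlled /controlled /= -diagf_adj.
  case: (y i == o); case: (all_o s y); rewrite ?mulmx1 ?mul1mx //=.
  + exact/esym/unitarymxP/Xd_unitary.
  + by rewrite (unitarymxP (diagf_unitary hb)).
apply: cost_mul (IH _ js hbc pbc); apply: cost_mul; last first.
  exact/cost_controlled/Xd_conj_adj/Xd_conj_X.
apply: cost_mul (IH _ js hb pb); exact/cost_controlled/Xd_conj_X.
Qed.

Definition phase_op s (w : C) : Op :=
  mkop (fun x y => (if all_o s y then w else 1) *+ (x == y)).

(** With [v^d = w], the phase [w] on one value of [j] is [v] times a diagonal gate of determinant 1.
    The latter is a multiply controlled gate, and [v] is a phase with one control fewer. *)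
Lemma cost_phase_op (i0 : 'I_r) s w : uniq s -> w * w^* = 1 ->
  cost (\sum_(0 <= c < size s) (2 ^ c.+1 - 2)) (phase_op s w).
Proof.
elim: s w => [|j s IH] w /=.
  move=> _ hw; rewrite big_geq //.
  have -> : phase_op [::] w = w%:M.
    by apply: entryP => x y; rewrite mkopE /entry !mxE (inj_eq enum_rank_inj).
  exact: (cost_scalar _ i0 hw).
move=> /andP[js us] hw; rewrite big_nat_recr //= addnC.
pose v := d.-root w.
have hv : v ^+ d = w by rewrite rootCK // (ltn_trans _ hd).
have hvv : v * v^* = 1.
  apply/eqP; rewrite -(@pexpr_eq1 _ _ d) ?mul_conjC_ge0 ?(ltn_trans _ hd) //.
  by rewrite exprMn -rmorphXn /= hv hw.
pose f a := (if a == o then w else 1) * v^*.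
have hf a : f a * (f a)^* = 1.
  rewrite /f rmorphM /= conjCK mulrACA [v^* * v]mulrC hvv mulr1.
  by case: ifP; rewrite ?conjC1 ?mulr1.
have pf : \prod_a f a = 1.
  rewrite big_split /= prodr_const card_ord -rmorphXn /= hv (bigD1 o) //=.
  by rewrite eqxx big1 ?mulr1 // => a /negbTE ->.
have -> : phase_op (j :: s) w =
    mux j (multi_controlled s (diagf f)) *m phase_op s v.
  have -> : phase_op s v = mux j (fun y => (if all_o s y then v else 1)%:M).
    by rewrite mux_scalar.
  rewrite mux_mul; last exact: free_of_multi_controlled.
  rewrite /phase_op.
  pose g y a := if all_o s y then (if a == o then w else 1) else 1.
  transitivity (mux j (fun y => diagf (g y))); last first.
    apply: eq_mux => y; rewrite /multi_controlled /g.
    case: (all_o s y); apply/matrixP => a b; rewrite mul_mx_scalar !mxE.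
      by rewrite mulrnAr /f mulrCA hvv mulr1.
    by rewrite mulrnAr mulr1.
  rewrite (mux_diag j g); apply: entryP => x y; rewrite !mkopE /g /=.
  by case: (y j == o); case: (all_o s y).
apply: cost_mul; first exact: cost_multi_controlled.
exact: IH.
Qed.

Definition word_o : W := [ffun=> o].

Lemma all_o_enum y : all_o (enum 'I_r) y = (y == word_o).
Proof.
apply/allP/eqP => [h|-> i _]; last by rewrite ffunE.
by apply/ffunP=> i; rewrite ffunE; apply/eqP/h; rewrite mem_enum.
Qed.

Lemma phase_op_enum w : phase_op (enum 'I_r) w =
  1%:M - (1 - w) *: (delta_mx (enum_rank word_o) 0 *m
                     (delta_mx (enum_rank word_o) (0 : 'I_1))^t*).
Proof.
apply: entryP => x y; rewrite mkopE all_o_enum /entry !mxE big_ord1.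
rewrite !mxE !(inj_eq enum_rank_inj) !eqxx !andbT conjC_nat.
case: (eqVneq x y) => [<-|xy].
  case: (x == word_o); rewrite /= ?mulr1n ?mulr0 ?mulr1 ?subr0 //.
  by rewrite opprB addrC subrK.
have [e|_] := eqVneq x word_o; rewrite /= ?mul0r ?mulr0 ?subr0 //.
by rewrite -e [y == x]eq_sym (negbTE xy) mulr0 mulr0 subr0.
Qed.

Lemma cost_reflection (i0 : 'I_r) n S b (z : 'cV[C]_#|{: W}|) c :
  cost n S -> S *m z = b *: delta_mx (enum_rank word_o) 0 ->
  c + c^* = c * c^* * dot z z ->
  cost (2 * n + \sum_(0 <= k < r) (2 ^ k.+1 - 2)) (reflection z c).
Proof.
move=> hS Sz hc; have US := cost_unitary hS.
set e0 := delta_mx _ _ in Sz.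
have hb : b * b^* = dot z z.
  rewrite -(dot_unitary z z US) Sz dotZl dotZr.
  by rewrite dot_delta mxE !eqxx mulr1 mulrC.
(* Unitarity of [S] gives [b b^* = <z, z>], so [w] is the factor by which the reflection multiplies
   [z]; [hc] says that it has modulus 1. *)
pose w := 1 - c * (b * b^*).
have bb : (b * b^*)^* = b * b^* by rewrite rmorphM /= conjCK mulrC.
have hw : w * w^* = 1.
  rewrite /w rmorphB rmorphM /= bb conjC1 hb.
  have -> : (1 - c * dot z z) * (1 - c^* * dot z z) =
     1 - (c + c^* - c * c^* * dot z z) * dot z z by ring.
  by rewrite hc subrr mul0r subr0.
have zE : z = b *: (S^t* *m e0).
  by rewrite scalemxAr -Sz mulmxA unitarymxVP // mul1mx.
have -> : reflection z c = S^t* *m phase_op (enum 'I_r) w *m S.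
  rewrite phase_op_enum -/e0 mulmxBr mulmxBl mulmx1 unitarymxVP //.
  rewrite /reflection zE adjmx_scale adjmx_mul trmxCK.
  rewrite -!scalemxAr -!scalemxAl !scalerA !mulmxA /w.
  congr (_ - _ *: _); ring.
rewrite mul2n -addnn addnAC; apply: cost_mul => //; apply: cost_mul.
  exact: cost_adj.
have := cost_phase_op i0 (enum_uniq 'I_r) hw.
by rewrite size_enum_ord.
Qed.

End MultiControl.
End CincCircuits.

(** * The count [T] for state preparation *)

Definition prep_cost (d k : nat) : nat := \sum_(0 <= c < k) (d ^ c - 1).

(** The recursion behind [compress_slice]: one more qudit makes [d] branches on the other [k], and
    in [d - 1] of them each of the [k] otherwise free gates needs one CINC gate. *)
Lemma prep_costS d k : (0 < d)%N ->
  prep_cost d k.+1 = (prep_cost d k * d + d.-1 * k)%N.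
Proof.
move=> d0; rewrite /prep_cost big_nat_recl // subnn add0n.
rewrite big_distrl /= -[in (d.-1 * k)%N](subn0 k) mulnC -sum_nat_const_nat.
rewrite -big_split /=; apply: eq_bigr => c _.
have : (0 < d ^ c)%N by rewrite expn_gt0 d0.
rewrite expnS; nia.
Qed.

Lemma prep_costE d k : (2 <= d)%N ->
  prep_cost d k = ((d ^ k - 1) %/ (d - 1) - k)%N.
Proof.
move=> hd; rewrite !subn1 predn_exp mulKn; last by rewrite -subn1 subn_gt0.
rewrite -(big_mkord xpredT) /=; set t := (X in (X - k)%N).
have -> : (t - k = t - \sum_(0 <= c < k) 1)%N.
  by rewrite sum_nat_const_nat subn0 muln1.
by rewrite /t -sumnB // => c _; rewrite expn_gt0 (ltn_trans _ hd).
Qed.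

(** * Compressing a vector to one basis word *)

Section StatePreparation.
Variables (C : numClosedFieldType) (d r : nat).
Hypothesis hd : (2 <= d)%N.
Variable o : 'I_d.
Local Notation W := (word d r).
Local Notation Op := (qop C d r).
Local Notation cost := (cost (@CINC C d r)).
Local Notation coef v x := (v (enum_rank x) 0).
Local Notation all_o := (all_o o).
Implicit Types (S : Op) (v : 'cV[C]_#|{: W}|) (x y z w : W) (i j : 'I_r).
Implicit Types (s : seq 'I_r) (P : pred W).

Definition agree_off s x y := [forall k, (k \notin s) ==> (x k == y k)].

Lemma agree_offP s x y :
  reflect (forall k, k \notin s -> x k = y k) (agree_off s x y).
Proof.
apply: (iffP forallP) => h k.
  by move=> hk; have := h k; rewrite hk => /eqP.
by apply/implyP => /h ->.
Qed.

Lemma agree_off_trans s y x z :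
  agree_off s x y -> agree_off s y z -> agree_off s x z.
Proof.
move=> /agree_offP h1 /agree_offP h2.
by apply/agree_offP=> k hk; rewrite h1 // h2.
Qed.

Lemma agree_off_sym s x y : agree_off s x y = agree_off s y x.
Proof. by apply: eq_forallb => k; rewrite [x k == _]eq_sym. Qed.

Lemma agree_off_refl s x : agree_off s x x.
Proof. exact/agree_offP. Qed.

Lemma agree_off_sub s t x y : {subset s <= t} ->
  agree_off s x y -> agree_off t x y.
Proof.
move=> st /agree_offP h; apply/agree_offP=> k hk; apply: h.
by apply: contra hk; apply: st.
Qed.

Lemma agree_off_upd s i x b : i \in s -> agree_off s x (upd x i b).
Proof.
by move=> hi; apply/agree_offP=> k; rewrite ffunE; case: eqP => // ->; rewrite hi.
Qed.

Definition acts_on s S := forall x y, ~~ agree_off s x y -> entry S x y = 0.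

Definition fixes s P S :=
  forall x y, all_o s y -> ~~ P y -> entry S x y = (x == y)%:R.

Lemma acts_on_sub s t S : {subset s <= t} -> acts_on s S -> acts_on t S.
Proof.
move=> st h x y hxy; apply: h.
by apply: contra hxy; exact: agree_off_sub.
Qed.

Lemma acts_on_mul s S1 S2 : acts_on s S1 -> acts_on s S2 -> acts_on s (S1 *m S2).
Proof.
move=> h1 h2 x y hxy; rewrite entry_mul big1 // => z _.
have [hxz|hxz] := boolP (agree_off s x z); last by rewrite h1 ?mul0r.
by rewrite h2 ?mulr0 //; apply: contra hxy; exact: agree_off_trans.
Qed.

Lemma fixes_mul s P S1 S2 : fixes s P S1 -> fixes s P S2 -> fixes s P (S1 *m S2).
Proof.
move=> h1 h2 x y sy Py; rewrite entry_mul (bigD1 y) //= big1 ?addr0.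
  by rewrite h1 // h2 // eqxx mulr1.
by move=> z zy; rewrite h2 // (negbTE zy) mulr0.
Qed.

Definition mux_if P i (U : 'M[C]_d) : Op :=
  mux i (fun y => if P y then U else 1%:M).

Lemma acts_on_mux_if P s i U : i \in s -> acts_on s (mux_if P i U).
Proof.
move=> hi x y hxy; rewrite mkopE; case: (boolP (agree i x y)) => // /agreeP e.
by case/negP: hxy; rewrite e; exact: agree_off_upd.
Qed.

Lemma fixes_mux_if P s i U : fixes s P (mux_if P i U).
Proof.
move=> x y _ Py; rewrite -(entry1 C x y) -(mux1 C d i) !mkopE.
by rewrite (negbTE Py).
Qed.

(* The words agreeing with [w] off [s] form a slice; [S] compresses [v] on the
   slice to the word whose entries on [s] are all [o].  The gates that need no
   control of their own are conditioned on [P], each at cost [q]; all other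
   gates are controlled by a value different from [o] of a qudit in [s], so
   slices on which [P] fails and that are already compressed stay so. *)
Lemma compress_slice s : uniq s -> forall P q,
  (forall x y, agree_off s x y -> P x = P y) ->
  (forall j (u : 'cV[C]_d), j \in s ->
     exists2 U, cost q (mux_if P j U) & exists b, U *m u = b *: delta_mx o 0) ->
  forall v w, P w -> exists S,
    [/\ cost (q * size s + prep_cost d (size s)) S, acts_on s S, fixes s P S
      & forall x, agree_off s x w -> ~~ all_o s x -> coef (S *m v) x = 0].
Proof.
elim: s => [|i s IH] /=.
  move=> _ P q _ _ v w _; exists 1%:M; split=> //.
  - by apply: cost_le (cost1 _).
  - move=> x y; rewrite entry1; case: eqVneq => // -> /negP[].
    exact: agree_off_refl.
  - by move=> x y _ _; rewrite entry1.
move=> /andP[si us] P q hP hfree v w Pw.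
have sub : {subset s <= i :: s} by move=> k hk; rewrite inE hk orbT.
have ii : i \in i :: s by rewrite inE eqxx.
have agree_si x b : agree_off (i :: s) x w -> x i = b ->
    agree_off s x (upd w i b).
  move=> /agree_offP h xi; apply/agree_offP => k hk; rewrite ffunE.
  by case: (k =P i) => [->//|/eqP ki]; rewrite h // inE negb_or ki.
(* The slice is split by the value at [i]; the branches for [o] and for the values in [L] are
   compressed one after the other. *)
have blocks (L : seq 'I_d) : o \notin L -> exists S,
    [/\ cost (q * size s + prep_cost d (size s)
              + size L * (size s + prep_cost d (size s))) S,
        acts_on (i :: s) S, fixes (i :: s) P S &
        forall x, agree_off (i :: s) x w -> x i \in o :: L -> ~~ all_o s x ->
          coef (S *m v) x = 0].
  elim: L => [|a L IHL].
    (* The branch [o] comes first and inherits the condition [P] and its cost [q]. *)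
    move=> _; have [|||S [cS aS fS rS]] := IH us P q _ _ v (upd w i o).
    - by move=> x y /(agree_off_sub sub)/hP.
    - by move=> j u js; apply: hfree; exact: sub.
    - by rewrite -(hP w) // agree_off_upd.
    exists S; rewrite mul0n addn0; split=> //.
    - exact: acts_on_sub aS.
    - by move=> x y /andP[_ sy]; exact: fS.
    - by move=> x hx; rewrite inE => /eqP xi; apply: rS; exact: agree_si.
  rewrite inE negb_or => /andP[oa oL].
  have [S' [cS' aS' fS' rS']] := IHL oL.
  (* The branch [a] is conditioned on qudit [i] having value [a], at cost 1. As [a] differs from
     [o], words that are [o] on all of [i :: s] are untouched. *)
  have [|||S [cS aS fS rS]] :=
      IH us (fun y => y i == a) 1%N _ _ (S' *m v) (upd w i a).
  - by move=> x y /agree_offP h; rewrite h.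
  - move=> j u js; have [U hU hb] := Xd_conj_reduces o u hd.
    exists U => //; apply: cost_controlled => //.
    by apply: contraNneq si => ->.
  - by rewrite upd_eq.
  exists (S *m S'); split.
  - by rewrite mulSn addnCA; move: cS; rewrite mul1n => /cost_mul; apply.
  - by apply: acts_on_mul => //; exact: acts_on_sub aS.
  - apply: fixes_mul => // x y /andP[/eqP yi sy] _; apply: fS => //.
    by rewrite yi.
  - move=> x hx xL sx; rewrite -mulmxA.
    have [xa|xa] := eqVneq (x i) a; first by apply: rS => //; exact: agree_si.
    (* In an earlier branch, [S] fixes the compressed words, and at the other words of the branch
       [S' v] already vanishes. *)
    rewrite entry_mulv big1 // => y _.
    have [sxy|sxy] := boolP (agree_off s x y); last by rewrite aS // mul0r.
    have yi : y i = x i by rewrite ((agree_offP _ _ _ sxy) i si).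
    have [sy|sy] := boolP (all_o s y).
      rewrite fS // ?yi //; case: eqVneq => [exy|_]; last by rewrite mul0r.
      by rewrite exy sy in sx.
    rewrite rS' ?mulr0 //.
      apply: agree_off_trans hx; rewrite agree_off_sym.
      exact: agree_off_sub sxy.
    by rewrite yi; move: xL; rewrite !inE (negbTE xa).
have [|S [cS aS fS rS]] := blocks (rem o (enum 'I_d)).
  by rewrite mem_rem_uniq ?enum_uniq // inE eqxx.
(* The slice now lives on the [d] words [upd z i a]; one further gate on [i], conditioned on [P],
   merges their amplitudes. *)
pose z : W := [ffun k => if k \in s then o else w k].
have [U cU [b hb]] := hfree i (\col_a coef (S *m v) (upd z i a)) ii.
exists (mux_if P i U *m S); split.
- have := cost_mul cU cS; apply: cost_le.
  rewrite size_rem ?mem_enum // size_enum_ord prep_costS ?(ltnW hd) //.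
  move: hd; case: (d) => // d' _ /=; nia.
- by apply: acts_on_mul => //; apply: acts_on_mux_if.
- by apply: fixes_mul => //; apply: fixes_mux_if.
move=> x hx; rewrite negb_and => hox; rewrite -mulmxA mux_mulv; last first.
  by move=> y c; rewrite -(hP y) // agree_off_upd.
rewrite (hP _ _ hx) Pw.
have updL a : coef (S *m v) (upd x i a) = 0 \/ all_o s x.
  have [sx|sx] := boolP (all_o s x); [by right|left; apply: rS].
  - by apply: agree_off_trans hx; rewrite agree_off_sym agree_off_upd.
  - rewrite upd_eq inE; case: eqP => //= /eqP ao.
    by rewrite mem_rem_uniq ?enum_uniq // inE ao mem_enum.
  - by rewrite all_o_upd.
have [sx|sx] := boolP (all_o s x); last first.
  rewrite big1 // => a _; case: (updL a) => [->|]; first by rewrite mulr0.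
  by rewrite (negbTE sx).
rewrite sx orbF in hox.
have xz a : upd x i a = upd z i a.
  apply/ffunP=> k; rewrite !ffunE; case: (k =P i) => // /eqP ki.
  case: ifP => [ks|ks]; first exact/eqP/(allP sx).
  by rewrite (agree_offP _ _ _ hx) // inE negb_or ki ks.
transitivity ((U *m (\col_a coef (S *m v) (upd z i a))) (x i) 0).
  by rewrite mxE; apply: eq_bigr => a _; rewrite xz mxE.
by rewrite hb !mxE (negbTE hox) mulr0.
Qed.

(** The whole register is one slice: with [P] always true, the gates conditioned on [P] are local,
    hence [q = 0]. *)
Lemma state_preparation v : exists2 S, cost (prep_cost d r) S &
  exists b, S *m v = b *: delta_mx (enum_rank (word_o r o)) 0.
Proof.
have [||//|S [cS _ _ rS]] :=
    @compress_slice (enum 'I_r) (enum_uniq _) predT 0%N _ _ v (word_o r o).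
- by [].
- move=> j u _; have [U hU hb] := unitary_reduces o u.
  by exists U => //; exact: (@cost_local _ _ _ (@CINC C d r) j U hU).
exists S; first by move: cS; rewrite size_enum_ord.
exists (coef (S *m v) (word_o r o)); apply/colP=> k.
rewrite -[k]enum_valK; set x := enum_val k.
rewrite [RHS]mxE [delta_mx _ _ _ _]mxE (inj_eq enum_rank_inj) andbT.
have [->|xo] := eqVneq x (word_o r o); first by rewrite mulr1.
rewrite mulr0; apply: rS; first by apply/agree_offP=> i; rewrite mem_enum.
by rewrite all_o_enum.
Qed.

End StatePreparation.

(** * Completing orthonormal columns to a circuit *)

Section Isometry.
Variables (C : numClosedFieldType) (d r : nat).
Hypotheses (hd : (2 <= d)%N) (hr : (0 < r)%N).
Local Notation W := (word d r).
Local Notation Op := (qop C d r).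
Local Notation cost := (cost (@CINC C d r)).

Lemma cost_any_reflection (z : 'cV[C]_#|{: W}|) c :
  c + c^* = c * c^* * dot z z -> cost (4 * prep_cost d r) (reflection z c).
Proof.
move=> hc; pose o := Ordinal (ltnW hd).
have [S hS [b Sz]] := state_preparation hd o z.
apply: cost_le (cost_reflection hd (Ordinal hr) hS Sz hc).
(* Termwise, [2^(k + 1) - 2 = 2 (2^k - 1) <= 2 (d^k - 1)]. *)
have : (\sum_(0 <= k < r) (2 ^ k.+1 - 2) <= 2 * prep_cost d r)%N.
  rewrite /prep_cost big_distrr /=; apply: leq_sum => k _.
  rewrite mulnBr muln1 expnS leq_sub2r // leq_pmul2l //.
  by case: k => // k; rewrite leq_exp2r.
lia.
Qed.

(** One reflection per column. A column [v b] already placed is orthogonal to [v a], and to [A e_a]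
    because [A] is unitary; the reflection along their difference therefore fixes it. *)
Lemma isometry_circuit (T : eqType) (e : T -> W) (v : T -> 'cV[C]_#|{: W}|)
    (s : seq T) :
  injective e -> (forall a b, dot (v a) (v b) = (a == b)%:R) -> uniq s ->
  exists2 A, cost (size s * (4 * prep_cost d r)) A &
    forall a, a \in s -> A *m delta_mx (enum_rank (e a)) 0 = v a.
Proof.
move=> inj_e hv; elim: s => [|a s IH] /=.
  by move=> _; exists 1%:M; [exact: cost1|].
move=> /andP[sa us]; have [A cA hA] := IH us.
have UA := cost_unitary hd cA.
pose u := A *m delta_mx (enum_rank (e a)) (0 : 'I_1).
have huv : dot u u = dot (v a) (v a).
  by rewrite dot_unitary // dot_delta mxE hv !eqxx.
exists (reflection (u - v a) (reflection_coef u (v a)) *m A).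
  rewrite mulSn; apply: cost_mul => //.
  exact/cost_any_reflection/reflection_coefP.
move=> b; rewrite inE -mulmxA; case: (eqVneq b a) => [-> _|ba /= hb].
  exact: reflection_maps.
rewrite hA //; apply: reflection_fix.
rewrite dotBl hv -(hA b hb) dot_unitary // dot_delta mxE.
rewrite (inj_eq enum_rank_inj) (inj_eq inj_e) [a == b]eq_sym (negbTE ba).
by rewrite subrr.
Qed.

End Isometry.

(** * CINC from SUM gates in prime dimension *)

Section Sum.
Variable C : numClosedFieldType.

(** Dimension [d.+2] makes the index type the ring of residues, where the shift is addition of 1. *)
Lemma Xd_expE d k (a c : 'I_d.+2) :
  ((Xd C d.+2 : 'M[C]_d.+2) ^+ k) a c = (a == c + k%:R)%:R.
Proof.
elim: k a => [|k IH] a; first by rewrite expr0 addr0 mxE.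
rewrite exprS Xd_mul IH; congr ((nat_of_bool _)%:R).
have e (b : 'I_d.+2) : ordS b = b + 1 by apply: val_inj; rewrite /= addn1.
by rewrite -(inj_eq (can_inj (@ordSK d.+2))) ord_predK e -addrA -mulrSr.
Qed.

(** Each factor picks up the diagonal entry at the current index and then moves the index by [k]. *)
Lemma Xd_diag_expE d k m (mu : 'I_d.+2 -> C) (a c : 'I_d.+2) :
  ((Xd C d.+2 ^+ k *m diag_mx (\row_i mu i) : 'M[C]_d.+2) ^+ m) a c =
    (\prod_(0 <= t < m) mu (c + (k * t)%:R)) * (a == c + (k * m)%:R)%:R.
Proof.
elim: m a => [|m IH] a.
  by rewrite expr0 muln0 addr0 big_geq // mul1r mxE.
rewrite exprS -mulmxE mxE (bigD1 (a - k%:R)) //= big1 ?addr0; last first.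
  move=> b hb; rewrite mul_mx_diag mxE Xd_expE.
  by rewrite -subr_eq eq_sym (negbTE hb) !mul0r.
rewrite IH mul_mx_diag !mxE Xd_expE subrK eqxx mul1r big_nat_recr //=.
rewrite subr_eq -addrA -natrD -mulnSr.
case: eqP => [->|]; last by rewrite !mulr0.
by rewrite mulnSr natrD addrA addrK !mulr1 mulrC.
Qed.

(* For prime [d], the affine map [t |-> c + k t] runs over all residues. *)
Lemma Xd_diag_exp_prime d k (mu : 'I_d -> C) : prime d -> (0 < k < d)%N ->
  (Xd C d ^+ k *m diag_mx (\row_i mu i) : 'M[C]_d) ^+ d = (\prod_i mu i)%:M.
Proof.
case: d mu => [|[|d]] // mu dp /andP[k0 kd]; apply/matrixP=> a c.
rewrite Xd_diag_expE mxE mulnC natrM.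
have -> : (d.+2)%:R = 0 :> 'I_d.+2 by apply: val_inj; rewrite Zp_nat /= modnn.
rewrite mul0r addr0 mulr_natr; congr (_ *+ _).
have uk : k%:R \is a @GRing.unit 'I_d.+2.
  by rewrite (@unitZpE d.+2) // prime_coprime // gtnNdvd.
rewrite big_mkord [RHS](reindex (fun t : 'I_d.+2 => c + k%:R * t)) /=; last first.
  exists (fun t => k%:R^-1 * (t - c)) => t _.
    by rewrite addrAC subrr add0r mulKr.
  by rewrite mulVKr // addrC subrK.
apply: eq_bigr => t _; congr (mu (_ + _)).
by rewrite natrM; congr (_ * _); apply: val_inj; rewrite Zp_nat /= modn_small.
Qed.

Variables (d r : nat).
Hypothesis dp : prime d.
Local Notation X := (Xd C d).
Local Notation cost := (cost (@SUM C d r)).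

(** [X] is normal; [mu] consists of [d]-th roots of its eigenvalues, so that [X] is conjugate to a
    [d]-th power of a diagonal unitary. *)
Lemma Xd_roots : exists (P : 'M[C]_d) (mu : 'I_d -> C),
  [/\ P \is unitarymx, forall a, mu a * (mu a)^* = 1 &
      X = P^t* *m diag_mx (\row_a (mu a ^+ d)) *m P].
Proof.
have XX := unitarymxP (Xd_unitary C d); have d0 := prime_gt0 dp.
have /orthomx_spectralP : X \is normalmx.
  by apply/normalmxP; rewrite XX unitarymxVP // Xd_unitary.
set P := spectralmx _; set D := spectral_diag _ => XE.
have UP : P \is unitarymx by apply: spectral_unitarymx.
rewrite invmx_unitary // in XE.
have DE : diag_mx D = P *m X *m P^t*.
  by rewrite [in RHS]XE -!mulmxA (unitarymxP UP) mulmx1 mulmxA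
    (unitarymxP UP) mul1mx.
have UD : diag_mx D \is unitarymx.
  by rewrite DE !mul_unitarymx ?trmxC_unitary ?Xd_unitary.
exists P, (fun a => d.-root (D 0 a)); split=> //.
  move=> a; apply/eqP; rewrite -(@pexpr_eq1 _ _ d) ?mul_conjC_ge0 //.
  rewrite exprMn -rmorphXn /= rootCK //.
  have /matrixP/(_ a a) := unitarymxP UD.
  by rewrite mul_diag_mx !mxE eqxx !mulr1n => ->.
rewrite [LHS]XE; congr (_ *m diag_mx _ *m _); apply/rowP=> a.
by rewrite mxE rootCK.
Qed.

Lemma SUM_mux (i j : 'I_r) : SUM C d i j = mux j (fun y => X ^+ (y i)).
Proof. by apply: entryP => x y; rewrite !mkopE. Qed.

Lemma cost_SUM_CINC (i j : 'I_r) : i != j -> cost d (CINC C d i j).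
Proof.
move=> ij; have hd := prime_gt1 dp; have d0 := prime_gt0 dp.
have [P [mu [UP hmu XE]]] := Xd_roots.
pose B := diag_mx (\row_a mu a).
have UB : B \is unitarymx by exact: diagf_unitary.
pose f (c : 'I_d) := (X ^+ c *m B) ^+ d.
have cm m : cost m (mux j (fun y => (X ^+ y i *m B) ^+ m)).
  elim: m => [|m IH].
    have -> : mux j (fun y => (X ^+ y i *m B) ^+ 0) = 1%:M :> qop C d r.
      by rewrite -(mux1 C d j); apply: eq_mux.
    exact: cost1.
  have -> : mux j (fun y => (X ^+ y i *m B) ^+ m.+1) =
      SUM C d i j *m local_op j B *m mux j (fun y => (X ^+ y i *m B) ^+ m).
    have F1 := @free_of_ctl C d r i j (fun c => X ^+ c) ij.
    have F2 := @free_of_ctl C d r i j (fun c => X ^+ c *m B) ij.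
    rewrite SUM_mux mux_mul_local_op // mux_mul //.
    by apply: eq_mux => y; rewrite exprS.
  rewrite -add1n; apply: cost_mul IH; apply: cost_mulr.
    exact: cost_two.
  exact: cost_local.
have cf : cost d (mux j (fun y => f (y i))) by exact: cm.
pose o := Ordinal d0; pose om := Ordinal (ord_last_proof hd).
pose p := \prod_a mu a.
have Bm m : B ^+ m = diag_mx (\row_a (mu a ^+ m)).
  elim: m => [|m IH].
    rewrite expr0; apply/matrixP=> a b; rewrite !mxE.
    by rewrite expr0.
  rewrite exprS -mulmxE IH /B mul_diag_mx; apply/matrixP=> a b; rewrite !mxE.
  by rewrite mulrnAr exprS.
have fo : f o = diag_mx (\row_a (mu a ^+ d)).
  by rewrite /f /= expr0 mul1mx Bm.
have fc c : c != o -> f c = p%:M.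
  rewrite -val_eqE /= -lt0n => c0.
  by apply: Xd_diag_exp_prime; rewrite // c0 ltn_ord.
have cf1 := @cost_target _ _ _ _ d j (P^t*) P _ (free_of_ctl f ij) _ UP cf.
rewrite trmxC_unitary in cf1; have {}cf1 := cf1 UP.
(* For nonzero control values the target carries the scalar [p], cancelled by a phase on the
   control. For value 0, conjugation by [P] has turned [B^d] into [X]; the transposition below moves
   this value to [d - 1]. *)
pose g c := if c == o then 1 else p^*.
have hp : p * p^* = 1 by rewrite /p rmorph_prod -big_split /= big1.
have hg c : g c * (g c)^* = 1.
  by rewrite /g; case: ifP; rewrite ?conjC1 ?mulr1 // conjCK mulrC hp.
have cf2 := cost_phase_ctl ij hg cf1.
rewrite (CINC_mux C hd).
have := @cost_relabel_ctl _ _ _ (@SUM C d r) d i j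
  (tperm o om)
  (fun c => g c *: (P^t* *m f c *m P)) ij cf2.
congr (cost d _); apply: eq_mux => y; rewrite /controlled /g.
have -> c : (tperm o om c == o) = (c == om).
  by rewrite -[LHS](inj_eq (@perm_inj _ (tperm o om))) tpermK tpermL.
case: eqP => [->|/eqP ne]; first by rewrite tpermR fo -XE scale1r.
rewrite fc; last first.
  by rewrite -(inj_eq (@perm_inj _ (tperm o om))) tpermK tpermL.
rewrite mul_mx_scalar -scalemxAl unitarymxVP // scalerA mulrC hp.
by rewrite scale1r.
Qed.

Lemma circuit_CINC_SUM k A : circuit (@CINC C d r) k A -> cost (d * k) A.
Proof.
elim=> [|{}k A' i j ij _ IH|{}k A' i U hU _ IH].
- exact: cost_le (cost1 _).
- rewrite mulnS; apply: cost_mul IH; exact: cost_SUM_CINC.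
- by apply: cost_mull => //; apply: cost_local.
Qed.

End Sum.

(** * Factoring positive semidefinite matrices *)

Section PositiveFactorization.
Variable C : numClosedFieldType.

Lemma psd_congr p q (A : 'M[C]_p) (B : 'M[C]_(p, q)) :
  psd A -> psd (B^t* *m A *m B).
Proof.
by move=> hA v; have := hA (B *m v); rewrite adjmx_mul !mulmxA.
Qed.

Lemma psd_diag p (A : 'M[C]_p) i : psd A -> 0 <= A i i.
Proof.
move/(_ (delta_mx i 0)); rewrite -mulmxA -[_ *m (A *m _)]/(_ *m _) => h.
by have := h; rewrite -[X in 0 <= X -> _]/(dot _ _) dot_delta -colE mxE.
Qed.

(** Polarization: the form is real at [e_i + a e_j], hence so is [a A_ij + a^* A_ji]; [a = 1] and
    [a = 'i] determine the entries. *)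
Lemma psd_hermitian p (A : 'M[C]_p) : psd A -> A^t* = A.
Proof.
move=> hA; apply/matrixP=> i j; rewrite adjmxE.
have q (a : C) :
    (a * A i j + a^* * A j i)^* = a * A i j + a^* * A j i.
  have hr (k : 'I_p) : (A k k)^* = A k k by apply/geC0_conj/psd_diag.
  pose v : 'cV[C]_p := delta_mx i 0 + a *: delta_mx j 0.
  have hv : (v^t* *m A *m v) 0 0 =
      A i i + a * a^* * A j j + (a * A i j + a^* * A j i).
    have dD u w t : dot (u + w) t = dot u t + dot w t :> C.
      by rewrite /dot adjmxD mulmxDl mxE.
    rewrite -mulmxA -[LHS]/(dot v (A *m v)) /v dD dotZl !dot_delta.
    rewrite mulmxDr -scalemxAr -!colE !mxE; ring.
  have := geC0_conj (hA v); rewrite hv rmorphD [X in X + _]rmorphD /=.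
  rewrite [(a * a^* * A j j)^*]rmorphM /= !hr rmorphM /= conjCK [a^* * a]mulrC.
  by move/addrI.
have q1 := q 1; have qi := q 'i.
rewrite conjC1 !mul1r rmorphD /= in q1.
rewrite conjCi !rmorphD !rmorphM /= rmorphN /= conjCi opprK in qi.
have {}qi : (A j i)^* - (A i j)^* = A i j - A j i.
  apply: (mulfI (neq0Ci C)); rewrite !mulrBr addrC -mulNr qi.
  by rewrite mulNr.
have n2 : 2 != 0 :> C by rewrite pnatr_eq0.
apply: (mulfI n2).
have -> : 2 * (A j i)^* =
    ((A i j)^* + (A j i)^*) + ((A j i)^* - (A i j)^*) by ring.
by rewrite q1 qi; ring.
Qed.

Lemma psd_factor p (A : 'M[C]_p) : psd A -> exists M : 'M[C]_p, A = M *m M^t*.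
Proof.
move=> hA; have hH := psd_hermitian hA.
have /orthomx_spectralP : A \is normalmx by apply/normalmxP; rewrite hH.
set P := spectralmx _; set D := spectral_diag _ => AE.
have UP : P \is unitarymx by apply: spectral_unitarymx.
rewrite invmx_unitary // in AE.
have DE : diag_mx D = (P^t*)^t* *m A *m P^t*.
  rewrite trmxCK [in RHS]AE -!mulmxA (unitarymxP UP) mulmx1 mulmxA.
  by rewrite (unitarymxP UP) mul1mx.
have D0 i : 0 <= D 0 i.
  have := psd_diag i (psd_congr (P^t*) hA).
  by rewrite -DE mxE eqxx mulr1n.
exists (P^t* *m diag_mx (map_mx sqrtC D)).
rewrite adjmx_mul trmxCK mulmxA -[P^t* *m _ *m _]mulmxA.
rewrite [LHS]AE; congr (_ *m _ *m _); apply/matrixP=> i j.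
rewrite mul_diag_mx !mxE rmorphMn /= eq_sym.
case: eqVneq => [->|_]; last by rewrite !mulr0n mulr0.
by rewrite !mulr1n geC0_conj ?sqrtC_ge0 // -expr2 sqrtCK.
Qed.

(* Since [A] is Hermitian, it is supported on both sides by its row space. *)
Lemma psd_factor_rank p k (A : 'M[C]_p) : psd A -> (\rank A <= k)%N ->
  exists M : 'M[C]_(p, k), A = M *m M^t*.
Proof.
move=> hA hk; have hH := psd_hermitian hA.
have [Q [B AQB]] : exists (Q : 'M[C]_(p, \rank A)) (B : 'M[C]_(\rank A, p)),
    A *m Q *m B = A.
  by exists (pinvmx (row_base A)), (row_base A); rewrite mulmxKpV ?eq_row_base.
move: (\rank A) hk Q B AQB => s hs Q B AQB.
have BQA : B^t* *m (Q^t* *m A) = A.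
  by rewrite -[in LHS]hH -!adjmx_mul AQB hH.
have AE : A = B^t* *m (Q^t* *m A *m Q) *m B.
  by rewrite mulmxA BQA AQB.
have [M QM] := psd_factor (psd_congr Q hA).
pose N := B^t* *m M.
have AN : A = N *m N^t* by rewrite /N adjmx_mul trmxCK {1}AE QM !mulmxA.
rewrite AN -(subnKC hs); exists (row_mx N 0).
by rewrite tr_row_mx map_col_mx mul_row_col trmx0 map_mx0 mulmx0 addr0.
Qed.

End PositiveFactorization.

Lemma adj_mxcol (C : numClosedFieldType) p q k (B : 'I_k -> 'M[C]_(p, q)) :
  (\mxcol_(i < k) B i)^t* = \mxrow_(i < k) (B i)^t*.
Proof. by rewrite tr_mxcol; apply/matrixP=> i j; rewrite !mxE. Qed.

(** * Concatenation of words *)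

Section Words.
Variable d : nat.

Lemma lword_cat m n (x : word d m) (y : word d n) : lword (catword x y) = x.
Proof.
apply/ffunP=> i; rewrite !ffunE; case: splitP => j /= e.
  by congr (x _); apply: val_inj.
by have := ltn_ord i; rewrite e ltnNge leq_addr.
Qed.

Lemma rword_cat m n (x : word d m) (y : word d n) : rword (catword x y) = y.
Proof.
apply/ffunP=> i; rewrite !ffunE; case: splitP => j /= e.
  by have := ltn_ord j; rewrite -e ltnNge leq_addr.
by congr (y _); apply: val_inj; apply/esym/(@addnI m).
Qed.

Lemma cat_lrword m n (z : word d (m + n)) : catword (lword z) (rword z) = z.
Proof.
apply/ffunP=> k; rewrite !ffunE; case: splitP => j /= e; rewrite ffunE;
  by congr (z _); apply: val_inj.
Qed.

Lemma sum_catword (V : nmodType) m n (F : word d (m + n) -> V) :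
  \sum_z F z = \sum_x \sum_y F (catword x y).
Proof.
rewrite pair_bigA /= (reindex (fun p => catword p.1 p.2)) //.
exists (fun z => (lword z, rword z)) => [[x y] _|z _] /=.
  by rewrite lword_cat rword_cat.
exact: cat_lrword.
Qed.

Lemma card_word n : #|{: word d n}| = (d ^ n)%N.
Proof. by rewrite card_ffun !card_ord. Qed.

End Words.

(** * From the Choi matrix to Kraus operators *)

Section Kraus.
Variables (C : numClosedFieldType) (d n m : nat).
Variable Phi : {linear qop C d n -> qop C d m}.
Hypothesis hPhi : quantum_channel Phi.
Local Notation "'rk' x" := (enum_rank x) (at level 10, x at level 9).

Lemma entry_choi (x x' : word d n) (y y' : word d m) :
  entry (choi Phi) (catword y x) (catword y' x') =
    entry (Phi (ketbra C x x')) y y'.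
Proof.
have entry_sum (I : finType) (F : I -> qop C d (m + n)) z z' :
    entry (\sum_i F i) z z' = \sum_i entry (F i) z z'.
  by rewrite /entry summxE.
have E a b : entry (tensor (Phi (ketbra C a b)) (ketbra C a b))
      (catword y x) (catword y' x') =
    entry (Phi (ketbra C a b)) y y' * ((x == a) && (x' == b))%:R.
  by rewrite mkopE !lword_cat !rword_cat /entry mxE !(inj_eq enum_rank_inj).
rewrite entry_sum (bigD1 x) //= entry_sum (bigD1 x') //=.
rewrite E !eqxx mulr1 !big1 ?addr0 //= => [a ax|b bx].
  rewrite entry_sum big1 // => b _.
  by rewrite E [x == a]eq_sym (negbTE ax) mulr0.
by rewrite E [x' == b]eq_sym (negbTE bx) andbF mulr0.
Qed.

Lemma form_words k (A : qop C d k) (u v : 'cV[C]_#|{: word d k}|) :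
  (u^t* *m A *m v) 0 0 =
    \sum_z \sum_z' (u (rk z) 0)^* * entry A z z' * v (rk z') 0.
Proof.
rewrite -mulmxA -[LHS]/(dot _ _) dotE sum_rank; apply: eq_bigr => z _.
by rewrite entry_mulv mulr_sumr; apply: eq_bigr => z' _; rewrite mulrA.
Qed.

(** Complete positivity is applied to the block matrix with blocks [|i><j|], which is [w w^*] for
    the unnormalized maximally entangled [w]. The rest reorders indices: blocks follow the input
    word, whereas [choi] puts the output word first. *)
Lemma choi_psd : psd (choi Phi).
Proof.
have [cp _] := hPhi; set p := #|{: word d n}|.
pose D (i j : 'I_p) : qop C d n := delta_mx i j.
have hD : psd (\mxblock_(i < p, j < p) D i j).
  pose w : 'M[C]_(\sum_(i < p) p, 1) := \mxcol_(i < p) (delta_mx i 0 : 'cV[C]_p).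
  have -> : \mxblock_(i < p, j < p) D i j = w *m w^t*.
    rewrite adj_mxcol mul_mxcol_mxrow.
    apply: eq_mxblock => i j; rewrite trmx_delta map_delta_mx.
    by rewrite mul_delta_mx.
  move=> v; rewrite mulmxA -mulmxA -[v^t* *m w]trmxCK adjmx_mul trmxCK.
  rewrite -[_ 0 0]/(dot _ _); exact: dot_ge0.
have {}hD := cp _ _ hD; move=> v.
pose u (i : 'I_p) : 'cV[C]_#|{: word d m}| :=
  \col_j v (rk (catword (enum_val j) (enum_val i))) 0.
have := hD (\mxcol_i u i); congr (0 <= _).
rewrite adj_mxcol mul_mxrow_mxblock mul_mxrow_mxcol.
pose T x x' y y' := (v (rk (catword y x)) 0)^* *
  entry (Phi (ketbra C x x')) y y' * v (rk (catword y' x')) 0.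
transitivity (\sum_x' \sum_x \sum_y \sum_y' T x x' y y').
  rewrite summxE sum_rank; apply: eq_bigr => x' _.
  rewrite mulmx_suml summxE sum_rank; apply: eq_bigr => x _.
  rewrite form_words; apply: eq_bigr => y _; apply: eq_bigr => y' _.
  by rewrite !mxE !enum_rankK.
rewrite form_words sum_catword; symmetry.
transitivity (\sum_y \sum_x \sum_y' \sum_x' T x x' y y').
  apply: eq_bigr => y _; apply: eq_bigr => x _; rewrite sum_catword.
  by apply: eq_bigr => y' _; apply: eq_bigr => x' _; rewrite entry_choi.
rewrite exchange_big /= [RHS]exchange_big /=; apply: eq_bigr => x _.
rewrite [RHS]exchange_big /=; apply: eq_bigr => y _.
exact: exchange_big.
Qed.

(** The columns of a factor of the Choi matrix are Kraus operators [K_t], with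
    [V x t y = <y|K_t|x>]. Trace preservation becomes orthonormality of the vectors [V x]. *)
Lemma kraus l : (choi_rank Phi <= d ^ l)%N ->
  exists V : word d n -> word d l -> word d m -> C,
    (forall x x' y y', entry (Phi (ketbra C x x')) y y' =
       \sum_t V x t y * (V x' t y')^*) /\
    (forall x x', \sum_t \sum_y (V x t y)^* * V x' t y = (x == x')%:R).
Proof.
rewrite -card_word => /(psd_factor_rank choi_psd) [M hM].
exists (fun x t y => M (rk (catword y x)) (rk t)).
have PhiE x x' y y' : entry (Phi (ketbra C x x')) y y' =
    \sum_t M (rk (catword y x)) (rk t) * (M (rk (catword y' x')) (rk t))^*.
  rewrite -entry_choi hM /entry mxE sum_rank.
  by apply: eq_bigr => t _; rewrite adjmxE.
split=> // x x'; have [_ tp] := hPhi.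
have <- : \tr (ketbra C x' x) = (x == x')%:R :> C.
  rewrite /mxtrace sum_rank (bigD1 x') //= mxE eqxx (inj_eq enum_rank_inj).
  rewrite big1 ?addr0 1?eq_sym // => y yx.
  by rewrite mxE (inj_eq enum_rank_inj) (negbTE yx).
rewrite -tp /mxtrace sum_rank exchange_big /=; apply: eq_bigr => y _.
rewrite -[RHS]/(entry _ y y) PhiE; apply: eq_bigr => t _.
by rewrite mulrC.
Qed.

Lemma Phi_expand (rho : qop C d n) y y' :
  entry (Phi rho) y y' =
    \sum_x \sum_x' entry rho x x' * entry (Phi (ketbra C x x')) y y'.
Proof.
rewrite {1}[rho]matrix_sum_delta linear_sum /entry summxE sum_rank.
apply: eq_bigr => x _; rewrite linear_sum summxE sum_rank.
by apply: eq_bigr => x' _; rewrite linearZ mxE.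
Qed.

End Kraus.

(** * The circuit model of a channel *)

Section Model.
Variables (C : numClosedFieldType) (d n : nat).

(** [emb] prepends the zero ancilla word, the only one that the ancilla state leaves in the sums.
    With [r] a variable, case analysis on [e] removes the cast. *)
Lemma ancilla_embedding a r (e : (a + n)%N = r) : (0 < d)%N ->
  exists2 emb : word d n -> word d r, injective emb &
    forall (A : qop C d r) (rho : qop C d n) u u',
      entry (A *m ecast r (qop C d r) e (tensor (zero_state C d a) rho) *m A^t*)
        u u' =
      \sum_x \sum_x' entry A u (emb x) * entry rho x x' *
        (entry A u' (emb x'))^*.
Proof.
case: r / e => d0 /=; pose o := Ordinal d0; pose w := word_o a o.
exists (catword w) => [x x' /(congr1 (@rword _ _ _))|A rho u u'].
  by rewrite !rword_cat.
have zE (t : word d a) : [forall i, (t i == 0 :> nat)%N] = (t == w).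
  apply/forallP/eqP => [h|-> i]; last by rewrite ffunE.
  by apply/ffunP => i; apply/val_inj/eqP; rewrite ffunE; exact: h.
have TE t t' x x' : entry (tensor (zero_state C d a) rho)
    (catword t x) (catword t' x') = ((t == w) && (t' == w))%:R * entry rho x x'.
  by rewrite mkopE !lword_cat !rword_cat mkopE !zE.
have sum_w (F : word d a -> C) : (forall t, t != w -> F t = 0) ->
    \sum_t F t = F w.
  by move=> hF; rewrite (bigD1 w) //= big1 ?addr0.
rewrite entry_mul sum_catword sum_w => [|t tw]; last first.
  rewrite big1 // => x' _; rewrite entry_mul sum_catword !big1 ?mul0r // => t' _.
  by rewrite big1 // => x _; rewrite TE (negbTE tw) andbF mul0r mulr0.
rewrite exchange_big /=; apply: eq_bigr => x' _.
rewrite entry_mul sum_catword sum_w => [|t tw]; last first.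
  by rewrite big1 // => x _; rewrite TE (negbTE tw) mul0r mulr0.
rewrite mulr_suml; apply: eq_bigr => x _.
by rewrite TE !eqxx mul1r entry_adj.
Qed.

Lemma channel_circuit m (Phi : {linear qop C d n -> qop C d m}) l :
  (2 <= d)%N -> (0 < m)%N -> quantum_channel Phi ->
  (choi_rank Phi <= d ^ l)%N ->
  exists k (W : qop C d (l + m)),
    [/\ (k <= N_bound d n (l + m))%N, circuit (@CINC C d (l + m)) k W
      & circuit_model Phi (l + m - n)%N W].
Proof.
move=> hd hm hPhi hK; have d0 := ltnW hd.
have [V [VE Vorth]] := kraus hPhi hK.
pose v x : 'cV[C]_#|{: word d (l + m)}| :=
  \col_k V x (lword (enum_val k)) (rword (enum_val k)).
have vE x t y : v x (enum_rank (catword t y)) 0 = V x t y.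
  by rewrite mxE enum_rankK lword_cat rword_cat.
have hv x x' : dot (v x) (v x') = (x == x')%:R.
  rewrite dotE sum_rank sum_catword -Vorth.
  by apply: eq_bigr => t _; apply: eq_bigr => y _; rewrite !vE.
(* [d^n] orthonormal vectors fit into dimension [d^(l + m)], so the ancilla count [l + m - n] does
   not truncate. *)
have hn : (n <= l + m)%N.
  pose B : 'M[C]_(#|{: word d (l + m)}|, #|{: word d n}|) :=
    \matrix_(i, j) v (enum_val j) i 0.
  have : B^t* *m B = 1%:M.
    apply/matrixP=> i j; rewrite [RHS]mxE -(inj_eq enum_val_inj) -hv mxE dotE.
    by apply: eq_bigr => k _; rewrite adjmxE [B k i]mxE [B k j]mxE.
  by move/mulmx1_min; rewrite !card_word leq_exp2l.
have e : (l + m - n + n = l + m)%N by rewrite subnK.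
have [emb inj_emb embE] := ancilla_embedding e d0.
have hr : (0 < l + m)%N by rewrite addn_gt0 hm orbT.
have [A [k hk cA] hA] :=
  isometry_circuit hd hr inj_emb hv (enum_uniq {: word d n}).
exists k, A; split=> //.
  apply: leq_trans hk _; rewrite -cardE card_word prep_costE //.
  by rewrite /N_bound [(4 * d ^ n)%N]mulnC -mulnA leq_addr.
exists e => rho _; apply: entryP => y y'.
rewrite mkopE Phi_expand.
have AE u x : entry A u (emb x) = v x (enum_rank u) 0.
  rewrite -(hA x) ?mem_enum // entry_mulv (bigD1 (emb x)) //= big1 ?addr0.
    by rewrite mxE !eqxx mulr1.
  by move=> z zx; rewrite mxE (inj_eq enum_rank_inj) (negbTE zx) mulr0.
under [RHS]eq_bigr => t _ do rewrite embE.
rewrite [RHS]exchange_big /=; apply: eq_bigr => x _.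
rewrite [RHS]exchange_big /=; apply: eq_bigr => x' _.
rewrite VE mulr_sumr; apply: eq_bigr => t _.
by rewrite !AE !vE mulrA [entry rho x x' * _]mulrC.
Qed.

End Model.

Theorem theoremV6 (R : realType) (d n m : nat)
    (hd : (2 <= d)%N) (hn : (1 <= n)%N) (hm : (1 <= m)%N)
    (Phi : {linear qop R[i] d n -> qop R[i] d m})
    (hPhi : quantum_channel Phi) (K : nat) (hK : choi_rank Phi = K) :
  let l := up_log d K in
  (exists (k : nat) (W : qop R[i] d (l + m)),
     [/\ (k <= N_bound d n (l + m))%N,
         circuit (@CINC R[i] d (l + m)) k W &
         circuit_model Phi (l + m - n)%N W])
  /\
  (prime d ->
   exists (k : nat) (W : qop R[i] d (l + m)),
     [/\ (k <= d * N_bound d n (l + m))%N,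
         circuit (@SUM R[i] d (l + m)) k W &
         circuit_model Phi (l + m - n)%N W]).
Proof.
move=> l; have hKl : (choi_rank Phi <= d ^ l)%N by rewrite hK up_logP.
have [k [W [hk cW mW]]] := channel_circuit hd hm hPhi hKl.
split; first by exists k, W.
move=> dp; have [k' hk' cW'] := circuit_CINC_SUM dp cW.
exists k', W; split=> //.
by apply: leq_trans hk' _; rewrite leq_mul2l hk orbT.
Qed.
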